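(* Let $\delta>0$ be fixed and let $(X_t^{(n)})_{n\ge1}$ be a family of irreducible discrete-time $\delta$-lazy birth-and-death chains, with mixing times $t_{\mathrm{mix}}^{(n)}(\cdot)$ and relaxation times $t_{\mathrm{rel}}^{(n)}$. Then $(X_t^{(n)})$ exhibits cutoff in total variation if and only if $t_{\mathrm{rel}}^{(n)}=o\big(t_{\mathrm{mix}}^{(n)}(\frac14)\big)$ as $n\to\infty$, and the cutoff window size is at most $\sqrt{t_{\mathrm{mix}}^{(n)}(\frac14)\cdot t_{\mathrm{rel}}^{(n)}}$; that is, when cutoff occurs, $w_n=\sqrt{t_{\mathrm{mix}}^{(n)}(\frac14)\cdot t_{\mathrm{rel}}^{(n)}}$ is a cutoff window for the family.
   Context: A (discrete-time) birth-and-death chain is a Markov chain with state space $\Omega=\{0,\ldots,N\}$ for some integer $N\ge1$ (which may differ from chain to chain) whose transition kernel $P$ satisfies $P(x,y)=0$ whenever $|x-y|>1$. It is $\delta$-lazy if $P(x,x)\ge\delta$ for all $x\in\Omega$. Let $\pi$ be the stationary distribution. With $\|\mu-\nu\|_{\mathrm{TV}}=\frac12\sum_x|\mu(x)-\nu(x)|$, put $d(t)=\max_{x\in\Omega}\|P^t(x,\cdot)-\pi\|_{\mathrm{TV}}$ for integers $t\ge0$, and $t_{\mathrm{mix}}(\epsilon)=\min\{t:d(t)\le\epsilon\}$ for $0<\epsilon<1$. The spectral gap is $\mathrm{gap}=1-\lambda$, where $\lambda$ is the largest absolute value of all nontrivial eigenvalues of $P$, and $t_{\mathrm{rel}}=\mathrm{gap}^{-1}$.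 A superscript $(n)$ indicates the quantity for the $n$-th chain. The family exhibits cutoff (in total variation) if $\lim_{n\to\infty}t_{\mathrm{mix}}^{(n)}(\epsilon)/t_{\mathrm{mix}}^{(n)}(1-\epsilon)=1$ for every $0<\epsilon<1$. A sequence $w_n$ is a cutoff window if $w_n=o\big(t_{\mathrm{mix}}^{(n)}(\frac14)\big)$ and for every $\epsilon\in(0,1)$ there is $c_\epsilon>0$ such that $t_{\mathrm{mix}}^{(n)}(\epsilon)-t_{\mathrm{mix}}^{(n)}(1-\epsilon)\le c_\epsilon w_n$ for all $n$. *)

(* Defs.v *)
From mathcomp Require Import all_boot all_order all_algebra.
From mathcomp Require Import all_classical all_reals all_analysis.
From mathcomp Require Import complex.
Set Implicit Arguments.
Unset Strict Implicit.
Unset Printing Implicit Defensive.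
Import Order.TTheory GRing.Theory Num.Theory.
Import numFieldNormedType.Exports.
Local Open Scope classical_set_scope.
Local Open Scope ring_scope.
Local Open Scope complex_scope.

Section Chain.
Variables (R : realType) (N : nat).
Implicit Types (P : 'M[R]_N.+1) (mu nu pi : 'rV[R]_N.+1).

Definition distribution_on mu : Prop :=
  (forall x, 0 <= mu 0 x) /\ \sum_x mu 0 x = 1.

Definition stochastic P : Prop := forall x, distribution_on (row x P).

Definition birth_death P : Prop :=
  stochastic P /\ forall x y : 'I_N.+1, (1 < `|x - y|)%N -> P x y = 0.

Definition lazy (delta : R) P : Prop := forall x, delta <= P x x.

Definition irreducible P : Prop :=
  forall x y, exists t : nat, 0 < (P ^+ t) x y.

Definition stationary P pi : Prop := distribution_on pi /\ pi *m P = pi.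

Definition tv mu nu : R := 2^-1 * \sum_x `|mu 0 x - nu 0 x|.

Definition dist_stat P pi (t : nat) : R :=
  \big[Num.max/0]_(x < N.+1) tv (row x (P ^+ t)) pi.

(* The value 0 is a default for chains that never get [eps]-close to [pi];
   it is not reached for irreducible [delta]-lazy chains with [delta > 0]. *)
Definition tmix P pi (eps : R) : nat :=
  if pselect (exists t, dist_stat P pi t <= eps) is left ex_t
  then ex_minn ex_t else 0%N.

(* Eigenvalues are taken in the complex numbers [R[i]], and an eigenvalue is
   nontrivial when it differs from 1 (which is simple when [P] is irreducible).
   The set of moduli is finite, and nonempty when [P] is irreducible and
   [N >= 1], so its supremum is then a maximum. *)
Definition lambda P : R :=
  sup [set r : R | exists z : R[i],
    [/\ eigenvalue (map_mx (real_complex R) P) z, z != 1 & r%:C = `|z|]].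

Definition gap P : R := 1 - lambda P.

Definition trel P : R := (gap P)^-1.

End Chain.

Section Family.
Variable R : realType.

(* [tm n eps] is the mixing time of the [n]-th chain at level [eps]. A quotient
   by [tm n (1 - eps) = 0] is 0, hence far from the limit 1. *)
Definition cutoff (tm : nat -> R -> nat) : Prop :=
  forall eps : R, 0 < eps < 1 ->
    ((tm n eps)%:R / (tm n (1 - eps))%:R : R) @[n --> \oo] --> (1 : R).

Definition cutoff_window (tm : nat -> R -> nat) (w : nat -> R) : Prop :=
  w =o_\oo (fun n => (tm n 4^-1)%:R : R) /\
  forall eps : R, 0 < eps < 1 -> exists2 c : R, 0 < c &
    forall n, (tm n eps)%:R - (tm n (1 - eps))%:R <= c * w n.

End Family.

(* Main.v *)
Require Import Defs.
From mathcomp Require Import all_boot all_order all_algebra.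
From mathcomp Require Import all_classical all_reals all_analysis.
From mathcomp Require Import complex spectral ring lra zify.
Set Implicit Arguments.
Unset Strict Implicit.
Unset Printing Implicit Defensive.
Import Order.TTheory GRing.Theory Num.Theory.
Import numFieldNormedType.Exports.
Local Open Scope classical_set_scope.
Local Open Scope ring_scope.

(** Let [T = trel]. For a mean-zero [h], a maximal inequality for the iterates
    [P^s h] yields a state [z] in the bulk [a, b] of [pi] at which [P^s h] is
    small for all [s] between [K T] and [t] simultaneously; from any other state
    the chain inherits this bound once it has hit [z]. So [d t] is controlled by
    tails of hitting times of bulk states from the two ends. Poincare's
    inequality, applied to the mean hitting time itself, bounds the variance of
    these hitting times by [O(T)] times their mean; applied to the potential
    between [a] and [b], it bounds the time needed to cross the bulk by [O(T)].
    Hence, if [M] is the larger of the mean hitting times of [b] from [0] and of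
    [a] from [N], Chebyshev's inequality shows that [d] drops from [1 - 2 eps]
    to [eps] within a time [O(sqrt(T M) + T)] around [M].

    Conversely, if [trel] is not [o(tmix)], then either [T] is large and the
    second eigenvalue keeps [d] bounded below for times of order [tmix], or
    [tmix] is bounded and laziness forbids [d] to drop from [1 - eps] to [eps]
    in a single step. *)

(** The function [h] is the centred sign function dual to one row of [P^t], so it depends on the
    start and on [t], and hence so does [z]. This is harmless because the hitting bounds are uniform
    over the bulk. The time left after hitting [z] is random, so [P^s h] must be small at [z] for
    all [s] at once. As the level is an arbitrary [eps], a maximal inequality with a fixed constant
    would not do, whence the burn-in [K T]. The exact law of hitting times is replaced by a
    supermartingale built from explicit sums over edges.

    The window should involve [tmix] and not [M]. Once [T] is at most [tmix] at level 1/4, the lower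
    bound on [d] forces [M = O(tmix)], which turns [sqrt(T M)] and [T] into the required window. The
    same bound makes the mixing times at all levels comparable, so that a window of smaller order
    gives cutoff. *)

Lemma cauchy_schwarz_sum (R : realDomainType) (I : finType) (w f g : I -> R) :
  (forall x, 0 <= w x) ->
  (\sum_x w x * (f x * g x)) ^+ 2 <=
  (\sum_x w x * f x ^+ 2) * (\sum_x w x * g x ^+ 2).
Proof.
move=> w0; set A := \sum_x w x * f x ^+ 2; set B := \sum_x w x * g x ^+ 2.
set C := \sum_x w x * (f x * g x).
have A0 : 0 <= A by apply: sumr_ge0 => x _; rewrite mulr_ge0 ?sqr_ge0.
have pos a b : 0 <= a ^+ 2 * A + 2 * (a * b) * C + b ^+ 2 * B.
  have -> : a ^+ 2 * A + 2 * (a * b) * C + b ^+ 2 * B =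
            \sum_x w x * (a * f x + b * g x) ^+ 2.
    rewrite !mulr_sumr -!big_split /=; apply: eq_bigr => x _; ring.
  by apply: sumr_ge0 => x _; rewrite mulr_ge0 ?sqr_ge0.
have [A_eq0|A_neq0] := eqVneq A 0.
  have C0 : C = 0.
    apply: big1 => x _; have := psumr_eq0P _ A_eq0 (i := x) isT.
    move=> /(_ (fun i _ => mulr_ge0 (w0 i) (sqr_ge0 (f i))))/eqP.
    rewrite mulf_eq0 sqrf_eq0 => /orP[] /eqP ->; last by rewrite mul0r mulr0.
    by rewrite mul0r.
  by rewrite C0 expr0n /= mulr_ge0 // sumr_ge0 // => x _; rewrite mulr_ge0 ?sqr_ge0.
have Agt0 : 0 < A by rewrite lt_def A_neq0.
have := pos (- C) A.
have -> : (- C) ^+ 2 * A + 2 * (- C * A) * C + A ^+ 2 * B = A * (A * B - C ^+ 2).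
  ring.
by rewrite pmulr_rge0 // subr_ge0.
Qed.

(** * The Markov operator acting on functions *)

Section Averaging.
Variables (R : realType) (N : nat) (P : 'M[R]_N.+1).
Implicit Types f g : 'I_N.+1 -> R.

Definition avg f (x : 'I_N.+1) : R := \sum_y P x y * f y.

Lemma iter_avgE f t x : iter t avg f x = \sum_y (P ^+ t) x y * f y.
Proof.
elim: t x => [|t IH] x /=.
  rewrite expr0 (bigD1 x) //= mxE eqxx mul1r big1 ?addr0 // => y yx.
  by rewrite mxE eq_sym (negbTE yx) mul0r.
rewrite /avg (eq_bigr _ (fun y _ => congr1 _ (IH y))).
under eq_bigr do rewrite mulr_sumr.
rewrite exchange_big /=; apply: eq_bigr => z _.
by rewrite exprS mxE mulr_suml; apply: eq_bigr => y _; rewrite mulrA.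
Qed.

Lemma avgD f g x : avg (fun y => f y + g y) x = avg f x + avg g x.
Proof. by rewrite /avg -big_split; apply: eq_bigr => y _; rewrite mulrDr. Qed.

Hypothesis P_stoch : stochastic P.

Lemma stoch_ge0 x y : 0 <= P x y.
Proof. by have [/(_ y)] := P_stoch x; rewrite mxE. Qed.

Lemma stoch_sum1 x : \sum_y P x y = 1.
Proof. by have [_ <-] := P_stoch x; apply: eq_bigr => y _; rewrite mxE. Qed.

Lemma avg_cst c x : avg (fun=> c) x = c.
Proof. by rewrite /avg -mulr_suml stoch_sum1 mul1r. Qed.

Lemma norm_avg_le f C x : (forall y, `|f y| <= C) -> `|avg f x| <= C.
Proof.
move=> fC; rewrite -(avg_cst C x) /avg (le_trans (ler_norm_sum _ _ _)) //.
apply: ler_sum => y _; rewrite normrM ger0_norm ?stoch_ge0 //.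
by rewrite ler_wpM2l ?stoch_ge0.
Qed.

Lemma norm_iter_avg_le f C t x :
  (forall y, `|f y| <= C) -> `|iter t avg f x| <= C.
Proof. by move=> fC; elim: t x => [|t IH] x //=; exact: norm_avg_le. Qed.

Lemma stochasticX t : stochastic (P ^+ t).
Proof.
have pos s x y : 0 <= (P ^+ s) x y.
  elim: s x y => [|s IH] x y; first by rewrite expr0 mxE ler0n.
  by rewrite exprS mxE sumr_ge0 // => z _; rewrite mulr_ge0 ?stoch_ge0.
move=> x; split=> [y|]; first by rewrite mxE.
transitivity (iter t avg (fun=> 1) x).
  by rewrite iter_avgE; apply: eq_bigr => y _; rewrite mxE mulr1.
elim: t x => [|t IH] x //=.
by rewrite -[RHS](avg_cst 1 x); apply: eq_bigr => y _; rewrite IH.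
Qed.

End Averaging.

(* [T] plays the role of the relaxation time, entering only through the
   contraction [rbd_contr], which is stable under the reflection [rev_ord]. *)
Record reversible_bd (R : realType) (N : nat) (P : 'M[R]_N.+1)
    (pi : 'rV[R]_N.+1) (T : R) : Prop := ReversibleBD {
  rbd_stoch : stochastic P;
  rbd_near : forall x y : 'I_N.+1, (1 < `|x - y|)%N -> P x y = 0;
  rbd_pos : forall x, 0 < pi 0 x;
  rbd_sum : \sum_x pi 0 x = 1;
  rbd_bal : forall x y, pi 0 x * P x y = pi 0 y * P y x;
  rbd_edge : forall x y : 'I_N.+1, y = x.+1 :> nat -> 0 < P x y;
  rbd_T : 1 <= T;
  rbd_contr : forall h : 'I_N.+1 -> R, \sum_x pi 0 x * h x = 0 ->
    \sum_x pi 0 x * avg P h x ^+ 2 <= (1 - T^-1) ^+ 2 * \sum_x pi 0 x * h x ^+ 2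
}.

(** * Poincare's inequality and hitting times *)

Section BirthDeath.
Variables (R : realType) (N : nat) (P : 'M[R]_N.+1) (pi : 'rV[R]_N.+1) (T : R).
Hypothesis H : reversible_bd P pi T.
Implicit Types (h : 'I_N.+1 -> R) (phi G : nat -> R).

Let P_stoch := rbd_stoch H.
Let pi_ge0 x : 0 <= pi 0 x. Proof. exact/ltW/(rbd_pos H). Qed.

Lemma rbd_T_gt0 : 0 < T. Proof. exact: lt_le_trans ltr01 (rbd_T H). Qed.

Lemma sum_avg h : \sum_x pi 0 x * avg P h x = \sum_x pi 0 x * h x.
Proof.
under eq_bigr do rewrite mulr_sumr.
rewrite exchange_big /=; apply: eq_bigr => y _.
under eq_bigr do rewrite mulrA (rbd_bal H) -mulrA.
by rewrite -mulr_sumr -mulr_suml (stoch_sum1 P_stoch) mul1r.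
Qed.

Lemma avg_selfadjoint (f g : 'I_N.+1 -> R) :
  \sum_x pi 0 x * (avg P f x * g x) = \sum_x pi 0 x * (f x * avg P g x).
Proof.
under eq_bigr do rewrite mulr_suml mulr_sumr.
rewrite exchange_big /=; apply: eq_bigr => y _.
rewrite mulr_sumr mulr_sumr; apply: eq_bigr => x _.
by rewrite -[P x y * _ * _]mulrA mulrA (rbd_bal H); ring.
Qed.

(** Centring [h] changes neither side. For the centred [g], Cauchy-Schwarz and [rbd_contr] bound the
    correlation of [g] with [avg P g] by [1 - 1 / T] times the variance. *)
Lemma poincare h :
  \sum_x pi 0 x * h x ^+ 2 - (\sum_x pi 0 x * h x) ^+ 2 <=
  T * \sum_x pi 0 x * (h x * (h x - avg P h x)).
Proof.
set m := \sum_x pi 0 x * h x; pose g x := h x - m.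
have sum_g : \sum_x pi 0 x * g x = 0.
  under eq_bigr do rewrite mulrBr.
  by rewrite sumrB -mulr_suml (rbd_sum H) mul1r subrr.
have avg_g x : avg P g x = avg P h x - m.
  by rewrite /g (avgD _ _ (fun=> - m)) avg_cst.
have -> : \sum_x pi 0 x * h x ^+ 2 - m ^+ 2 = \sum_x pi 0 x * g x ^+ 2.
  have -> : \sum_x pi 0 x * g x ^+ 2 = \sum_x (pi 0 x * h x ^+ 2
      - (2 * m) * (pi 0 x * h x) + m ^+ 2 * pi 0 x).
    by apply: eq_bigr => x _; rewrite /g; ring.
  by rewrite big_split sumrB /= -!mulr_sumr (rbd_sum H) -/m; ring.
have -> : \sum_x pi 0 x * (h x * (h x - avg P h x)) =
          \sum_x pi 0 x * (g x * (g x - avg P g x)).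
  under [RHS]eq_bigr do rewrite avg_g /g.
  apply/eqP; rewrite -subr_eq0 -sumrB.
  rewrite (eq_bigr (fun x => m * (pi 0 x * h x - pi 0 x * avg P h x))).
    by rewrite -mulr_sumr sumrB sum_avg subrr mulr0.
  by move=> x _; ring.
set A := \sum_x pi 0 x * g x ^+ 2.
have A0 : 0 <= A by apply: sumr_ge0 => x _; rewrite mulr_ge0 ?sqr_ge0.
set l := 1 - T^-1.
have l0 : 0 <= l by rewrite subr_ge0 invf_le1 ?rbd_T_gt0 ?(rbd_T H).
set B := \sum_x pi 0 x * (g x * avg P g x).
have B2 : B ^+ 2 <= (l * A) ^+ 2.
  apply: (le_trans (cauchy_schwarz_sum _ _ pi_ge0)).
  rewrite exprMn mulrC expr2 mulrA ler_wpM2r //; exact: (rbd_contr H).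
have Bl : B <= l * A.
  apply: le_trans (ler_norm B) _.
  by rewrite -ler_sqr ?nnegrE ?mulr_ge0 // real_normK ?num_real.
have -> : \sum_x pi 0 x * (g x * (g x - avg P g x)) = A - B.
  by rewrite -sumrB; apply: eq_bigr => x _; ring.
have TA : T * (l * A) = T * A - A.
  by rewrite /l mulrA mulrBr mulr1 divff ?gt_eqF ?rbd_T_gt0 // mulrBl mul1r.
have := ler_wpM2l (ltW rbd_T_gt0) Bl; lra.
Qed.

(* [0] for [k >= N], so that boundary terms need no special treatment. *)
Definition cond (k : nat) : R :=
  if (k < N)%N then pi 0 (inord k) * P (inord k) (inord k.+1) else 0.

Definition cdf (k : nat) : R := \sum_(x < N.+1 | (x <= k)%N) pi 0 x.

(* The mean hitting time of [z] from [k <= z]. *)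
Definition hmean (z k : nat) : R := \sum_(k <= i < z) cdf i / cond i.

Lemma cond_gt0 k : (k < N)%N -> 0 < cond k.
Proof.
move=> kN; rewrite /cond kN mulr_gt0 ?(rbd_pos H) // (rbd_edge H) //.
by rewrite !inordK // ltnW.
Qed.

Lemma cond_ge0 k : 0 <= cond k.
Proof.
by case: (ltnP k N) => [/cond_gt0/ltW //|kN]; rewrite /cond ltnNge kN.
Qed.

Lemma cdf_ge0 k : 0 <= cdf k.
Proof. by apply: sumr_ge0 => x _. Qed.

Lemma cdf_le1 k : cdf k <= 1.
Proof.
rewrite -(rbd_sum H) /cdf big_mkcond /=; apply: ler_sum => x _.
by case: ifP.
Qed.

Lemma cdf0 : cdf 0 = pi 0 ord0.
Proof.
rewrite /cdf (big_pred1 ord0) // => x.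
by rewrite leqn0.
Qed.

Lemma cdfS k : (k < N)%N -> cdf k.+1 = cdf k + pi 0 (inord k.+1).
Proof.
move=> kN; rewrite /cdf (bigD1 (inord k.+1)) ?inordK //= addrC; congr (_ + _).
apply: eq_bigl => x; rewrite -val_eqE /= inordK //; lia.
Qed.

(** With [G x = 0] the holding probability drops out. At [x = 0] the second term vanishes since
    [0.-1 = 0]; at [x = N] the first one does since [cond N = 0]. *)
Lemma flux (x : 'I_N.+1) G : G x = 0 ->
  pi 0 x * (\sum_y P x y * G y) = cond x * G x.+1 + cond x.-1 * G x.-1.
Proof.
move=> Gx; rewrite mulr_sumr.
have E (y : 'I_N.+1) : pi 0 x * (P x y * G y) =
  (if y == x.+1 :> nat then cond x * G x.+1 else 0) +
  (if y.+1 == x :> nat then cond x.-1 * G x.-1 else 0).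
  have [yx|ny] := eqVneq (y : nat) x.+1.
    rewrite (_ : (y.+1 == x :> nat) = false); last by lia.
    have xN : (x < N)%N by have := ltn_ord y; lia.
    rewrite addr0 /cond xN -yx mulrA; congr (_ * _ * _); first by rewrite inord_val.
    by rewrite !inord_val.
  rewrite add0r; have [yx|ny'] := eqVneq y.+1 (x : nat).
    have xN : (x.-1 < N)%N by have := ltn_ord x; lia.
    rewrite /cond xN -yx /= inord_val yx inord_val mulrA (rbd_bal H).
    by [].
  have [->|nxy] := eqVneq y x; first by rewrite Gx !mulr0.
  rewrite (rbd_near H) ?mul0r ?mulr0 //.
  by move: nxy; rewrite -val_eqE /= => nxy; lia.
rewrite (eq_bigr _ (fun y _ => E y)) big_split /= -!big_mkcond /=; congr (_ + _).
  rewrite (big_ord1_eq _ (fun=> cond x * G x.+1)).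
  case: ifP => // /negbT; rewrite -leqNgt ltnS => Nx.
  by rewrite /cond ltnNge Nx mul0r.
case: x Gx {E} => [[|k] /= kN] Gx; first by rewrite Gx mulr0 big_pred0.
under eq_bigl do rewrite eqSS.
by rewrite (big_ord1_eq _ (fun=> cond k * G k)) ltnW.
Qed.

Lemma laplacian (x : 'I_N.+1) phi :
  pi 0 x * (phi x - \sum_y P x y * phi y) =
  cond x * (phi x - phi x.+1) - cond x.-1 * (phi x.-1 - phi x).
Proof.
have -> : phi x - \sum_y P x y * phi y = - \sum_y P x y * (phi y - phi x).
  under [X in _ = - X]eq_bigr do rewrite mulrBr.
  by rewrite sumrB -mulr_suml (stoch_sum1 P_stoch) mul1r opprB.
rewrite mulrN (flux (G := fun k => phi k - phi x)) ?subrr //; ring.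
Qed.

Lemma energyE phi :
  \sum_(x < N.+1) pi 0 x * (phi x * (phi x - \sum_(y < N.+1) P x y * phi y)) =
  \sum_(0 <= i < N) cond i * (phi i - phi i.+1) ^+ 2.
Proof.
under eq_bigr do rewrite mulrCA laplacian mulrBr.
rewrite sumrB big_ord_recr [X in _ - X]big_ord_recl /= subrr !mulr0 add0r.
rewrite {2}/cond ltnn mul0r mulr0 addr0 -sumrB big_mkord.
by apply: eq_bigr => i _; rewrite /bump /=; ring.
Qed.

(** For [k < N] this is both the Dirichlet energy of [hmean k.+1] and its mean under [pi];
    [energy_le] rests on this coincidence. *)
Definition energy (k : nat) : R := \sum_(0 <= i < k.+1) cdf i ^+ 2 / cond i.

Lemma sum_ltn_step (F : nat -> R) z k :
  (k < z)%N -> \sum_(k <= i < z) F i - \sum_(k.+1 <= i < z) F i = F k.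
Proof. by move=> kz; rewrite big_ltn // addrK. Qed.

(** Write [c = cdf k] and [A] for the second moment of [phi]. Poincare gives [A - E^2 <= T E]; as
    [phi] vanishes beyond [k], Cauchy-Schwarz against the indicator of [[0, k]] gives [E^2 <= A c].
    Together [E (1 - c) <= T c]. *)
Lemma energy_le (eps : R) k : (k < N)%N -> 0 < eps -> cdf k <= 1 - eps ->
  energy k <= T / eps * cdf k.
Proof.
move=> kN eps0 ck; set E := energy k; pose phi x := hmean k.+1 x.
have E0 : 0 <= E.
  by apply: sumr_ge0 => i _; rewrite divr_ge0 ?sqr_ge0 ?cond_ge0.
have phi_out x : (k < x)%N -> phi x = 0 by move=> kx; rewrite /phi /hmean big_geq.
have dphi i : (i <= k)%N -> phi i - phi i.+1 = cdf i / cond i.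
  by move=> ik; rewrite /phi /hmean sum_ltn_step.
have energy_phi : \sum_(0 <= i < N) cond i * (phi i - phi i.+1) ^+ 2 = E.
  rewrite (big_cat_nat _ (n := k.+1)) //= [X in _ + X]big_nat_cond.
  rewrite [X in _ + X]big1 ?addr0 => [|i /andP[/andP[ki _] _]]; last first.
    by rewrite !phi_out ?subrr ?expr0n ?mulr0 // ltnW.
  apply: eq_big_nat => i /andP[_ ik]; rewrite dphi //.
  have /cond_gt0 ci : (i < N)%N by lia.
  by field; rewrite gt_eqF.
have mean_phi : \sum_(x < N.+1) pi 0 x * phi x = E.
  have widen (x : 'I_N.+1) :
      phi x = \sum_(0 <= i < k.+1) if (x <= i)%N then cdf i / cond i else 0.
    by rewrite /phi /hmean (big_nat_widenl _ 0) // big_mkcond.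
  under eq_bigr do rewrite widen mulr_sumr.
  rewrite exchange_big /E /energy /=; apply: eq_bigr => i _.
  rewrite expr2 -mulrA; set c := cdf i / cond i;
  rewrite /cdf mulr_suml [RHS]big_mkcond /=.
  by apply: eq_bigr => x _; case: ifP => _; rewrite ?mulr0.
have CS : E ^+ 2 <= (\sum_(x < N.+1) pi 0 x * phi x ^+ 2) * cdf k.
  have -> : cdf k = \sum_(x < N.+1) pi 0 x * ((x <= k)%:R) ^+ 2.
    rewrite /cdf big_mkcond; apply: eq_bigr => x _.
    by case: ifP => _; rewrite ?expr1n ?mulr1 ?expr0n ?mulr0.
  rewrite -mean_phi.
  rewrite (eq_bigr (fun x : 'I_N.+1 => pi 0 x * (phi x * (x <= k)%:R))).
    exact: (cauchy_schwarz_sum (fun x : 'I_N.+1 => phi x)).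
  move=> x _; have [//|kx] := leqP x k; first by rewrite mulr1.
  by rewrite phi_out // !mul0r.
have := poincare (fun x => phi x); rewrite energyE energy_phi mean_phi.
set A := \sum_x _ in CS * => PC.
have [->|En0] := eqVneq E 0.
  by rewrite mulr_ge0 ?cdf_ge0 // divr_ge0 ?ltW ?rbd_T_gt0.
have Egt0 : 0 < E by rewrite lt_def En0.
rewrite -(ler_pM2r Egt0) -(ler_pM2l eps0).
rewrite [leRHS](_ : _ = cdf k * (T * E)); last by field; rewrite gt_eqF.
have c0 := cdf_ge0 k.
have h1 : A * cdf k <= (E ^+ 2 + T * E) * cdf k.
  by apply: ler_wpM2r => //; rewrite addrC -lerBlDr.
have h2 : eps * E ^+ 2 <= (1 - cdf k) * E ^+ 2.
  by apply: ler_wpM2r; rewrite ?sqr_ge0 // lerBrDl addrC -lerBrDl.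
rewrite -expr2; move: h1 h2 CS; lra.
Qed.

(* Poincare's inequality for the potential of the unit current flow from [a]
   to [b]: the effective resistance is at most of order [T]. *)
Lemma resistance_le (eps : R) a b : (a < b)%N -> (b <= N)%N -> 0 < eps ->
  eps <= cdf a -> cdf b.-1 <= 1 - eps ->
  \sum_(a <= i < b) (cond i)^-1 <= 2 * T / eps.
Proof.
move=> ab bN eps0 ca cb; set Rab := \sum_(a <= i < b) _.
pose phi x := \sum_(maxn a x <= i < b) (cond i)^-1.
have phi_left x : (x <= a)%N -> phi x = Rab.
  by move=> xa; rewrite /phi; have -> : maxn a x = a by lia.
have phi_right x : (b <= x)%N -> phi x = 0.
  by move=> bx; rewrite /phi big_geq //; lia.
have energy_phi : \sum_(0 <= i < N) cond i * (phi i - phi i.+1) ^+ 2 = Rab.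
  rewrite (big_cat_nat _ (n := b)) //= [X in _ + X]big_nat_cond.
  rewrite [X in _ + X]big1 ?addr0 => [|i /andP[/andP[bi _] _]]; last first.
    by rewrite !phi_right ?subrr ?expr0n ?mulr0 // ltnW.
  rewrite (big_cat_nat _ (n := a)) /= ?(ltnW ab) //.
  rewrite [X in X + _]big_nat_cond.
  rewrite [X in X + _]big1 ?add0r => [|i /andP[/andP[_ ia] _]]; last first.
    by rewrite !phi_left ?subrr ?expr0n ?mulr0 // ltnW.
  apply: eq_big_nat => i /andP[ai ib].
  have -> : phi i - phi i.+1 = (cond i)^-1.
    rewrite /phi; have -> : maxn a i = i by lia.
    have -> : maxn a i.+1 = i.+1 by lia.
    exact: (sum_ltn_step (fun j => (cond j)^-1)).
  have /cond_gt0 ci : (i < N)%N by lia.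
  by field; rewrite gt_eqF.
have := poincare (fun x => phi x); rewrite energyE energy_phi.
set m := \sum_x pi 0 x * phi x.
have -> : \sum_(x < N.+1) pi 0 x * phi x ^+ 2 - m ^+ 2 =
          \sum_(x < N.+1) pi 0 x * (phi x - m) ^+ 2.
  have -> : \sum_(x < N.+1) pi 0 x * (phi x - m) ^+ 2 =
      \sum_(x < N.+1) (pi 0 x * phi x ^+ 2
        - (2 * m) * (pi 0 x * phi x) + m ^+ 2 * pi 0 x).
    by apply: eq_bigr => x _; ring.
  by rewrite big_split sumrB /= -!mulr_sumr (rbd_sum H) -/m; ring.
(* Only the two tails, where the potential is constant, are kept. *)
have low : cdf a * (Rab - m) ^+ 2 + (1 - cdf b.-1) * m ^+ 2 <=
           \sum_(x < N.+1) pi 0 x * (phi x - m) ^+ 2.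
  have -> : 1 - cdf b.-1 = \sum_(x < N.+1 | ~~ (x <= b.-1)%N) pi 0 x.
    rewrite -(rbd_sum H) (bigID (fun x : 'I_N.+1 => (x <= b.-1)%N)) /=.
    by rewrite addrAC subrr add0r.
  rewrite /cdf !mulr_suml [X in X + _]big_mkcond [X in _ + X]big_mkcond /=.
  rewrite -big_split /=; apply: ler_sum => x _.
  have sq := mulr_ge0 (pi_ge0 x) (sqr_ge0 (phi x - m)).
  case: ifP => xa; case: ifP => xb; first by exfalso; lia.
  - by rewrite addr0 phi_left.
  - by rewrite add0r phi_right ?sub0r ?sqrrN //; lia.
  - by rewrite addr0.
move=> PC; rewrite ler_pdivlMr //.
have R0 : 0 <= Rab by apply: sumr_ge0 => i _; rewrite invr_ge0 cond_ge0.
have [->|Rn0] := eqVneq Rab 0; first by rewrite mul0r mulr_ge0 // ltW // rbd_T_gt0.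
have Rgt0 : 0 < Rab by rewrite lt_def Rn0.
rewrite -(ler_pM2r Rgt0).
have h1 := ler_wpM2r (sqr_ge0 (Rab - m)) ca.
have cb' : eps <= 1 - cdf b.-1 by rewrite lerBrDl addrC -lerBrDl.
have h2 := ler_wpM2r (sqr_ge0 m) cb'.
(* This encodes [(Rab - m)^2 + m^2 >= Rab^2 / 2], the source of the factor 2. *)
have h3 : 0 <= eps * (Rab - 2 * m) ^+ 2 by rewrite mulr_ge0 ?sqr_ge0 ?ltW.
move: low PC h1 h2 h3; lra.
Qed.

Lemma hmean_ge0 z k : 0 <= hmean z k.
Proof. by apply: sumr_ge0 => i _; rewrite divr_ge0 ?cdf_ge0 ?cond_ge0. Qed.

Lemma hmean_mono z b k : (z <= b)%N -> hmean z k <= hmean b 0.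
Proof.
move=> zb; have [kz|zk] := leqP k z; last first.
  by rewrite {1}/hmean big_geq ?hmean_ge0 // ltnW.
have pos m n : 0 <= \sum_(m <= i < n) cdf i / cond i by exact: hmean_ge0.
rewrite /hmean (big_cat_nat _ (n := k) (p := b)) //=; last exact: leq_trans zb.
rewrite (big_cat_nat _ (n := z) (p := b)) //= addrCA lerDl addr_ge0 ?pos //.
Qed.

(** As [cdf <= 1], the mean time from [a] to [b] is at most the effective resistance between
    them. *)
Lemma hmean_resistance (eps : R) a b : (a <= b)%N -> (b <= N)%N -> 0 < eps ->
  eps <= cdf a -> (forall k, (k < b)%N -> cdf k <= 1 - eps) ->
  hmean b 0 <= hmean a 0 + 2 * T / eps.
Proof.
move=> ab bN eps0 ca cb; have T0 := rbd_T_gt0.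
have [->|nab] := eqVneq a b; first by rewrite lerDl divr_ge0 ?mulr_ge0 ?ltW.
have altb : (a < b)%N by rewrite ltn_neqAle nab.
rewrite /hmean (big_cat_nat _ (n := a)) //= lerD2l.
apply: le_trans (resistance_le altb bN eps0 ca _); last by apply: cb; lia.
apply: ler_sum_nat => i _; rewrite -[leRHS]mul1r ler_wpM2r ?cdf_le1 //.
by rewrite invr_ge0 cond_ge0.
Qed.

(* An upper bound for the variance of the hitting time of [z] from [k <= z]. *)
Definition hvar (z k : nat) : R :=
  \sum_(k <= i < z) (2 * energy i - cdf i ^+ 2 / cond i) / cond i.

Lemma hvar_step_ge0 i : 0 <= (2 * energy i - cdf i ^+ 2 / cond i) / cond i.
Proof.
rewrite divr_ge0 ?cond_ge0 // subr_ge0 /energy big_nat_recr //=.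
set s := \sum_(0 <= _ < i) _.
have s0 : 0 <= s by apply: sumr_ge0 => j _; rewrite divr_ge0 ?sqr_ge0 ?cond_ge0.
have q0 : 0 <= cdf i ^+ 2 / cond i by rewrite divr_ge0 ?sqr_ge0 ?cond_ge0.
by move: s0 q0; lra.
Qed.

Lemma hvar_ge0 z k : 0 <= hvar z k.
Proof. by apply: sumr_ge0 => i _; exact: hvar_step_ge0. Qed.

(** The factor [cdf i] in [energy_le] makes every increment of [hvar] a multiple of the matching
    increment [cdf i / cond i] of [hmean]. *)
Lemma hvar_le (eps : R) z k : (z <= N)%N -> 0 < eps ->
  (forall k, (k < z)%N -> cdf k <= 1 - eps) ->
  hvar z k <= 2 * T / eps * hmean z k.
Proof.
move=> zN eps0 cz; rewrite /hvar /hmean mulr_sumr.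
apply: ler_sum_nat => i /andP[_ iz].
have ci : 0 < cond i by apply: cond_gt0; exact: leq_trans iz zN.
rewrite mulrA ler_wpM2r ?invr_ge0 ?(ltW ci) //.
have := energy_le (leq_trans iz zN) eps0 (cz _ iz).
have : 0 <= cdf i ^+ 2 / cond i by rewrite divr_ge0 ?sqr_ge0 ?ltW.
rewrite [2 * T / eps * _](_ : _ = 2 * (T / eps * cdf i)) ?mulrA //; lra.
Qed.

(* [hsq z s x] dominates the second moment of [tau_z - s] from [x]. *)
Definition hsq (z : nat) (s : R) (x : nat) : R := (hmean z x - s) ^+ 2 + hvar z x.

Lemma hsq_ge z s x : (z <= x)%N -> hsq z s x = s ^+ 2.
Proof.
by move=> zx; rewrite /hsq /hmean /hvar !big_geq // sub0r sqrrN addr0.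
Qed.

(** One step lowers [hmean] by 1 on average, matching the shift of [s], and [hvar] pays for the
    second moment of that step. The two sides differ by exactly 1, the square of the drift, which
    the true variance would subtract. *)
Lemma hsq_super z s (x : 'I_N.+1) : (x < z)%N -> (z <= N)%N ->
  \sum_(y < N.+1) P x y * hsq z (s - 1) y <= hsq z s x.
Proof.
move=> xz zN; pose f := hmean z; pose v := hvar z.
pose q i := cdf i ^+ 2 / cond i.
have pix := rbd_pos H x.
have cn0 i : (i < z)%N -> cond i != 0.
  by move=> iz; rewrite gt_eqF // cond_gt0 // (leq_trans iz zN).
have df i : (i < z)%N -> f i - f i.+1 = cdf i / cond i.
  exact: sum_ltn_step.
have dv i : (i < z)%N -> v i - v i.+1 = (2 * energy i - q i) / cond i.
  exact: sum_ltn_step.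
have Lf : f x - \sum_(y < N.+1) P x y * f y = 1.
  apply: (mulfI (lt0r_neq0 pix)); rewrite laplacian mulr1.
  rewrite df // [cond x * _]mulrC divfK ?cn0 //.
  case: x xz {pix} => [[|k] /= kN] xz.
    by rewrite subrr mulr0 subr0 cdf0; congr (pi 0 _); apply: val_inj.
  rewrite df 1?ltnW // [cond k * _]mulrC divfK ?cn0 1?ltnW // cdfS // addrC addKr.
  by congr (pi 0 _); apply: val_inj; rewrite /= inordK.
(* The origin of the formula for [hvar]: [cond i * (v i - v i.+1)] is [2 * energy i - q i], and its
   difference between [x] and [x.-1] is [q x + q x.-1], the second moment of the step by [flux]. *)
have Lv : v x - \sum_(y < N.+1) P x y * v y =
          \sum_(y < N.+1) P x y * (f y - f x) ^+ 2.
  apply: (mulfI (lt0r_neq0 pix)); rewrite laplacian.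
  rewrite (flux (G := fun k => (f k - f x) ^+ 2)) ?subrr ?expr0n //.
  have cf i : (i < z)%N -> cond i * (f i.+1 - f i) ^+ 2 = q i.
    move=> iz; rewrite -opprB sqrrN df // /q.
    by field; rewrite cn0.
  rewrite cf // dv // [cond x * _]mulrC divfK ?cn0 //.
  case: x xz {pix Lf} => [[|k] /= kN] xz.
    by rewrite !subrr expr0n /= !mulr0 /energy big_nat1 -/(q 0%N); ring.
  rewrite -[f k - f k.+1]opprB sqrrN cf 1?ltnW // dv 1?ltnW //.
  rewrite [cond k * _]mulrC divfK ?cn0 1?ltnW // /energy.
  by rewrite [X in 2 * X - q k.+1]big_nat_recr //= -/(q k.+1); ring.
rewrite /hsq -/f -/v.
rewrite (eq_bigr (fun y : 'I_N.+1 => P x y * (f y - f x) ^+ 2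
    + (2 * (f x - s + 1)) * (P x y * f y) + P x y * v y
    + ((f x - s + 1) ^+ 2 - (2 * (f x - s + 1)) * f x) * P x y)); last first.
  by move=> y _; ring.
rewrite !big_split /= -!mulr_sumr (stoch_sum1 P_stoch) -Lv.
set Pf := \sum_y _ in Lf *; set Pv := \sum_y _.
have -> : f x = 1 + Pf by rewrite -Lf subrK.
rewrite -subr_ge0 [leRHS](_ : _ = 1) ?ler01 //; ring.
Qed.

(* Both tail bounds are Chebyshev's inequality for the hitting time of [z],
   proved by induction on time from [hsq_super]. In the first one, [g] is
   controlled at [z] only, so [x] inherits the control once [z] is hit. *)
Lemma hitting_upper_tail (g : 'I_N.+1 -> R) (eta : R) (u n : nat) (z x : 'I_N.+1) :
  0 <= eta -> (forall y, `|g y| <= 2) ->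
  (forall t, (u <= t <= n + u)%N -> `|iter t (avg P) g z| <= eta) ->
  (x <= z)%N -> hmean z x <= n%:R ->
  (`|iter (n + u) (avg P) g x| - eta) * (n%:R - hmean z x) ^+ 2 <=
  2 * hvar z x.
Proof.
move=> eta0 g2 gz xz.
(* The induction replaces [s] by [s - 1] and [x] by a neighbour, so [s] must be freed from
   [hmean z x]. *)
suff main (s : R) : s <= n%:R ->
    (`|iter (n + u) (avg P) g x| - eta) * (n%:R - s) ^+ 2 <= 2 * hsq z s x.
  by move/main; rewrite /hsq subrr expr0n add0r.
have zN : (z <= N)%N by rewrite -ltnS.
elim: n x xz gz s => [|n IH] x xz gz s sn.
  apply: (@le_trans _ _ (2 * s ^+ 2)).
    rewrite sub0r sqrrN ler_wpM2r ?sqr_ge0 // lerBlDr.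
    by apply: le_trans (norm_iter_avg_le P_stoch _ _ g2) _; rewrite lerDl.
  rewrite ler_pM2l // /hsq -[leLHS]addr0 lerD ?hvar_ge0 //.
  have := hmean_ge0 z x; nra.
have [->|nxz] := eqVneq x z.
  rewrite hsq_ge //; apply: (@le_trans _ _ 0); last by rewrite mulr_ge0 ?sqr_ge0.
  by rewrite mulr_le0_ge0 ?sqr_ge0 // subr_le0 gz // leq_addl leqnn.
have xz' : (x < z)%N by move: nxz; rewrite -val_eqE /= => nxz; lia.
apply: le_trans (ler_wpM2l _ (hsq_super s xz' zN)) => //.
apply: (@le_trans _ _ (\sum_(y < N.+1) P x y *
  ((`|iter (n + u) (avg P) g y| - eta) * (n.+1%:R - s) ^+ 2))).
  under eq_bigr do rewrite mulrA.
  rewrite -mulr_suml ler_wpM2r ?sqr_ge0 //.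
  under eq_bigr do rewrite mulrBr.
  rewrite sumrB -mulr_suml (stoch_sum1 P_stoch) mul1r lerD2r addSn /=.
  apply: le_trans (ler_norm_sum _ _ _) _; apply: ler_sum => y _.
  by rewrite normrM ger0_norm ?(stoch_ge0 P_stoch).
rewrite mulr_sumr; apply: ler_sum => y _; rewrite [leRHS]mulrCA.
(* A nearest-neighbour step from below [z] cannot jump over [z]. *)
have [yz|zy] := leqP y z; last first.
  by rewrite (rbd_near H) ?mul0r ?mulr0 //; lia.
apply: ler_wpM2l; first exact: stoch_ge0.
rewrite (_ : n.+1%:R - s = n%:R - (s - 1)); last by rewrite -natr1; ring.
apply: IH => // [t ht|]; first by apply: gz; lia.
by rewrite lerBlDr natr1.
Qed.

Lemma hitting_lower_tail (a t : nat) (x : 'I_N.+1) :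
  (a <= N)%N -> t%:R <= hmean a x ->
  (hmean a x - t%:R) ^+ 2 * iter t (avg P) (fun y : 'I_N.+1 => (a <= y)%:R) x <=
  hvar a x.
Proof.
move=> aN; set g := fun y : 'I_N.+1 => _.
suff main (s : R) : t%:R <= s ->
    (s - t%:R) ^+ 2 * iter t (avg P) g x <= hsq a s x.
  by move/main; rewrite /hsq subrr expr0n add0r.
have g01 r y : 0 <= iter r (avg P) g y <= 1.
  elim: r y => [|r IH] y /=; first by rewrite /g ler0n lern1 leq_b1.
  apply/andP; split.
    apply: sumr_ge0 => w _; rewrite mulr_ge0 ?(stoch_ge0 P_stoch) //.
    by case/andP: (IH w).
  rewrite -[leRHS](avg_cst P_stoch 1 y); apply: ler_sum => w _.
  by rewrite ler_wpM2l ?(stoch_ge0 P_stoch) //; case/andP: (IH w).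
elim: t x s => [|t IH] x s sn.
  rewrite subr0 /= /g; have [ax|xa] := leqP a x; first by rewrite mulr1 hsq_ge.
  by rewrite mulr0 addr_ge0 ?sqr_ge0 ?hvar_ge0.
(* From [a] on, only the trivial bound 1 is used: being at or above [a] at time [t] is relaxed to
   having reached [a] by then. *)
have [ax|xa] := leqP a x.
  rewrite hsq_ge //; apply: (@le_trans _ _ ((s - t.+1%:R) ^+ 2)).
    by rewrite -[leRHS]mulr1 ler_wpM2l ?sqr_ge0 //; case/andP: (g01 t.+1 x).
  have t0 : (0 : R) <= t.+1%:R by []; nra.
apply: le_trans (hsq_super s xa aN); rewrite /= /avg mulr_sumr.
apply: ler_sum => y _; rewrite mulrCA; apply: ler_wpM2l; first exact: stoch_ge0.
rewrite (_ : s - t.+1%:R = s - 1 - t%:R); last by rewrite -natr1; ring.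
by apply: IH; rewrite lerBrDr natr1.
Qed.

(** * A maximal inequality *)

Definition sqn (h : 'I_N.+1 -> R) : R := \sum_x pi 0 x * h x ^+ 2.

Lemma sqn_ge0 h : 0 <= sqn h.
Proof. by apply: sumr_ge0 => x _; rewrite mulr_ge0 ?sqr_ge0. Qed.

Lemma sum_iter_avg h t :
  \sum_x pi 0 x * iter t (avg P) h x = \sum_x pi 0 x * h x.
Proof. by elim: t => //= t <-; rewrite sum_avg. Qed.

Section Maximal.
Variable h : 'I_N.+1 -> R.
Hypothesis h_mean0 : \sum_x pi 0 x * h x = 0.

Let g k := iter k (avg P) h.
Let a k := sqn (g k).

Let a_decr k : T * a k.+1 <= T * a k - a k.
Proof.
have := rbd_contr H (etrans (sum_iter_avg h k) h_mean0).
rewrite -/(g k) -/(sqn (g k)) -/(a k) => le1.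
have Ti0 : 0 < T^-1 by rewrite invr_gt0 rbd_T_gt0.
have Ti1 : T^-1 <= 1 by rewrite invf_le1 ?rbd_T_gt0 // (rbd_T H).
have le2 : a k.+1 <= (1 - T^-1) * a k.
  apply: le_trans le1 _; rewrite ler_wpM2r ?sqn_ge0 //.
  by rewrite expr2 -[leRHS]mulr1 ler_wpM2l ?subr_ge0 // gerBl ltW.
apply: le_trans (ler_wpM2l (ltW rbd_T_gt0) le2) _.
by rewrite mulrA mulrBr mulr1 divff ?gt_eqF ?rbd_T_gt0 // mulrBl mul1r.
Qed.

Let a_ge0 k : 0 <= a k. Proof. exact: sqn_ge0. Qed.

Let a_anti k : a k.+1 <= a k.
Proof. by rewrite -(ler_pM2l rbd_T_gt0); have := a_decr k; have := a_ge0 k; lra. Qed.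

Let sum_a u m : \sum_(u <= k < u + m) a k <= T * a u.
Proof.
suff : \sum_(u <= k < u + m) a k <= T * a u - T * a (u + m)%N.
  by have := mulr_ge0 (ltW rbd_T_gt0) (a_ge0 (u + m)); lra.
elim: m => [|m IH]; first by rewrite addn0 big_geq // subrr.
rewrite addnS big_nat_recr ?leq_addr //=.
by have := a_decr (u + m); move: IH; lra.
Qed.

Let a_le u : u.+1%:R * a u <= T * a 0%N.
Proof.
have anti k m : a (k + m)%N <= a k.
  by elim: m => [|m IH]; rewrite ?addn0 // addnS (le_trans (a_anti _)).
apply: le_trans (sum_a 0 u.+1); rewrite add0n.
have -> : u.+1%:R * a u = \sum_(0 <= k < u.+1) a u.
  by rewrite sumr_const_nat subn0 mulr_natl.
by apply: ler_sum_nat => k /andP[_ ku]; rewrite -(subnKC (_ : k <= u)%N).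
Qed.

Let D k := \sum_x pi 0 x * (g k.+2 x - g k x) ^+ 2.

(** By self-adjointness the cross term of [g k.+2] and [g k] is the squared norm of [g k.+1]. *)
Let D_second_difference k : D k = a k - 2 * a k.+1 + a k.+2.
Proof.
have -> : a k.+1 = \sum_x pi 0 x * (g k.+2 x * g k x).
  by rewrite (avg_selfadjoint (g k.+1) (g k)).
rewrite /a /sqn mulr_sumr -sumrB -big_split /=; apply: eq_bigr => x _.
by rewrite /=; ring.
Qed.

(** Abel summation. On an eigenfunction of eigenvalue [x] it amounts to the sum of
    [(k + 1) x^(2k) (1 - x^2)^2] over all [k] being 1, which is why the weight [k + 1] is
    affordable. *)
Let sum_D m : \sum_(0 <= k < m) k.+1%:R * D k <= a 0%N.
Proof.
have -> : \sum_(0 <= k < m) k.+1%:R * D k =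
    a 0%N - a m - m%:R * (a m - a m.+1).
  elim: m => [|m IH]; first by rewrite big_geq // mul0r subr0 subrr.
  by rewrite big_nat_recr //= IH D_second_difference -natr1; ring.
have : 0 <= m%:R * (a m - a m.+1) by rewrite mulr_ge0 ?subr_ge0.
by have := a_ge0 m; lra.
Qed.

(* A maximal inequality whose constant is made small by starting late. The
   increments of [(P^t h)^2] along each parity class are bounded by AM-GM with
   weight [theta * (k + 1)], then summed using that [sqn (P^k h)] has second
   difference [sqn (P^(k+2) h - P^k h)]. *)
Lemma late_maximal (theta : R) (u m : nat) : 0 < theta ->
  T <= theta ^+ 2 * u.+1%:R ->
  exists2 U : 'I_N.+1 -> R,
    (forall x t, (u <= t <= u + m)%N -> iter t (avg P) h x ^+ 2 <= U x) &
    \sum_x pi 0 x * U x <= (2 * theta ^+ 2 + 5 / 2 * theta) * sqn h.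
Proof.
move=> th0 Tu.
pose U n x := g u x ^+ 2 + g u.+1 x ^+ 2 +
  \sum_(u <= k < u + n) `|g k.+2 x ^+ 2 - g k x ^+ 2|.
have Uge0 n x : 0 <= \sum_(u <= k < u + n) `|g k.+2 x ^+ 2 - g k x ^+ 2|.
  exact: sumr_ge0.
have U_step n x : U n.+1 x = U n x + `|g (u + n).+2 x ^+ 2 - g (u + n) x ^+ 2|.
  by rewrite /U addnS big_nat_recr ?leq_addr //= addrA.
have U_top n x : g (u + n) x ^+ 2 <= U n x /\ g (u + n).+1 x ^+ 2 <= U n x.
  elim: n => [|n [IH1 IH2]].
    rewrite addn0 /U addn0 big_geq // addr0.
    by rewrite lerDl lerDr !sqr_ge0.
  rewrite U_step addnS; split; first by rewrite (le_trans IH2) // lerDl.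
  rewrite -lerBlDl (le_trans _ (ler_norm _)) // lerD2l lerN2.
  exact: IH1.
have U_mono n j x : U n x <= U (n + j)%N x.
  by elim: j => [|j IH]; rewrite ?addn0 // addnS U_step (le_trans IH) // lerDl.
exists (U m) => [x t /andP[ut tm]|].
  rewrite -(subnKC ut); apply: le_trans (U_top (t - u)%N x).1 _.
  have -> : m = (t - u + (m - (t - u)))%N by lia.
  exact: U_mono.
have u1 : (0 : R) < u.+1%:R by [].
have E : \sum_x pi 0 x * U m x = a u + a u.+1 +
    \sum_(u <= k < u + m) \sum_x pi 0 x * `|g k.+2 x ^+ 2 - g k x ^+ 2|.
  rewrite exchange_big /= -!big_split /=; apply: eq_bigr => x _.
  by rewrite !mulrDr mulr_sumr.
have step k : (u <= k)%N ->
    \sum_x pi 0 x * `|g k.+2 x ^+ 2 - g k x ^+ 2| <=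
    theta / 2 * (k.+1%:R * D k) + (theta * u.+1%:R)^-1 * (a k + a k.+2).
  move=> uk; have k1 : (0 : R) < k.+1%:R by [].
  have ck : (theta * k.+1%:R)^-1 <= (theta * u.+1%:R)^-1.
    by rewrite lef_pV2 ?posrE ?mulr_gt0 // ler_pM2l // ler_nat.
  rewrite /D /a /sqn !mulr_sumr -big_split /= mulr_sumr -big_split /=.
  apply: ler_sum => x _; set X := avg P (avg P (g k)) x; set Y := g k x.
  rewrite (_ : theta / 2 * _ + _ = pi 0 x * (theta / 2 * k.+1%:R * (X - Y) ^+ 2
    + (theta * u.+1%:R)^-1 * (Y ^+ 2 + X ^+ 2))); last by ring.
  apply: ler_wpM2l => //.
  apply: (@le_trans _ _ (theta / 2 * k.+1%:R * (X - Y) ^+ 2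
    + (theta * k.+1%:R)^-1 * (Y ^+ 2 + X ^+ 2))); last first.
    by rewrite lerD2l ler_wpM2r // addr_ge0 ?sqr_ge0.
  set c := theta * k.+1%:R; have c0 : 0 < c by rewrite mulr_gt0.
  rewrite (_ : theta / 2 * k.+1%:R = c / 2); last by rewrite /c; ring.
  rewrite subr_sqr normrM -(ler_pM2l c0).
  have -> : c * (c / 2 * (X - Y) ^+ 2 + c^-1 * (Y ^+ 2 + X ^+ 2)) =
      (c * `|X - Y|) ^+ 2 / 2 + (`|X + Y| ^+ 2 + (X - Y) ^+ 2) / 2.
    by rewrite exprMn !real_normK ?num_real //; field; rewrite gt_eqF.
  have := sqr_ge0 (c * `|X - Y| - `|X + Y|); have := sqr_ge0 (X - Y).
  rewrite !expr2; nra.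
have sum_step : \sum_(u <= k < u + m) \sum_x pi 0 x * `|g k.+2 x ^+ 2 - g k x ^+ 2|
    <= theta / 2 * a 0%N + 2 * (theta * u.+1%:R)^-1 * (T * a u).
  apply: (@le_trans _ _ (\sum_(u <= k < u + m)
    (theta / 2 * (k.+1%:R * D k) + (theta * u.+1%:R)^-1 * (a k + a k.+2)))).
    by apply: ler_sum_nat => k /andP[uk _]; exact: step.
  rewrite big_split /= -!mulr_sumr; apply: lerD.
    apply: ler_wpM2l; first by rewrite divr_ge0 ?ltW.
    apply: le_trans (sum_D (u + m)).
    rewrite [leRHS](big_cat_nat _ (n := u)) ?leq_addr //= lerDr.
    apply: sumr_ge0 => k _; rewrite mulr_ge0 //.
    by apply: sumr_ge0 => x _; rewrite mulr_ge0 ?sqr_ge0.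
  rewrite [2 * _]mulrC -mulrA; apply: ler_wpM2l.
    by rewrite invr_ge0 mulr_ge0 ?ltW.
  apply: (@le_trans _ _ (\sum_(u <= k < u + m) (2 * a k))).
    apply: ler_sum_nat => k _; have := a_anti k; have := a_anti k.+1; lra.
  by rewrite -mulr_sumr ler_pM2l.
have au : a u <= theta ^+ 2 * a 0%N.
  rewrite -(ler_pM2l u1); apply: le_trans (a_le u) _.
  by rewrite mulrA [u.+1%:R * _]mulrC ler_wpM2r.
(* In the final constant, [2 * theta ^+ 2] comes from the two starting terms, [theta / 2] from the
   differences [D k], and [2 * theta] from the weighted sum of norms. *)
rewrite E -/(g 0%N) -/(a 0%N).
have last_term : (theta * u.+1%:R)^-1 * (T * a u) <= theta * a 0%N.
  rewrite ler_pdivrMl ?mulr_gt0 //.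
  rewrite [leRHS](_ : _ = theta ^+ 2 * u.+1%:R * a 0%N); last by ring.
  apply: ler_pM => //; first exact/ltW/rbd_T_gt0.
  by elim: (u) => // n; apply: le_trans.
have := a_anti u; move: sum_step last_term au; rewrite -[_ / _ * (T * _)]mulrA.
set W := (theta * _)^-1 * _; set S := \sum_(u <= k < u + m) _.
lra.
Qed.

End Maximal.

(** Markov's inequality for the maximal function [U] on a set of mass at least 1/2. With
    [th = eta^2 / 25], the mean of [U] is at most [4 (2 th^2 + 5 th / 2)], below
    [eta^2 / 2 = 25 th / 2]. *)
Lemma good_point h (eta : R) (u n a b : nat) :
  \sum_x pi 0 x * h x = 0 -> (forall x, `|h x| <= 2) -> 0 < eta <= 1 ->
  T <= (eta ^+ 2 / 25) ^+ 2 * u.+1%:R ->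
  2^-1 <= \sum_(x < N.+1 | (a <= x <= b)%N) pi 0 x ->
  exists2 z : 'I_N.+1, (a <= z <= b)%N &
    forall t, (u <= t <= n + u)%N -> `|iter t (avg P) h z| <= eta.
Proof.
move=> h0 h2 /andP[eta0 eta1] Tu mass.
have th0 : 0 < eta ^+ 2 / 25 by rewrite divr_gt0 ?exprn_gt0.
have [U Ut sumU] := late_maximal h0 n th0 Tu.
apply: contrapT => bad.
have big_U (x : 'I_N.+1) : (a <= x <= b)%N -> eta ^+ 2 <= U x.
  move=> xab; apply: contrapT => /negP; rewrite -ltNge => Ux.
  apply: bad; exists x => // t tu.
  rewrite -ler_sqr ?nnegrE ?(ltW eta0) // real_normK ?num_real //.
  by apply: le_trans (ltW Ux); apply: Ut; rewrite addnC.
have h4 : sqn h <= 4.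
  have -> : 4 = (\sum_x pi 0 x) * 4 by rewrite (rbd_sum H) mul1r.
  rewrite mulr_suml; apply: ler_sum => x _.
  rewrite ler_wpM2l // -real_normK ?num_real // (_ : 4 = 2 ^+ 2); last by ring.
  by rewrite ler_sqr ?nnegrE.
have U0 x : 0 <= U x.
  by apply: le_trans (Ut x u _); rewrite ?sqr_ge0 // leqnn leq_addr.
have : 2^-1 * eta ^+ 2 <= \sum_x pi 0 x * U x.
  apply: le_trans (ler_wpM2r (sqr_ge0 eta) mass) _.
  rewrite mulr_suml big_mkcond /=; apply: ler_sum => x _.
  by case: ifP => xab; [rewrite ler_wpM2l ?big_U | rewrite mulr_ge0].
move=> low; have := le_trans low sumU.
set th := eta ^+ 2 / 25 in th0 *.
have e2 : eta ^+ 2 = 25 * th by rewrite /th; field.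
have th1 : th <= 25^-1.
  rewrite /th -[leRHS]mul1r ler_pM2r ?invr_gt0 //.
  by rewrite expr_le1 // ltW.
rewrite e2 => le1.
have le2 : (2 * th ^+ 2 + 5 / 2 * th) * sqn h <= (2 * th ^+ 2 + 5 / 2 * th) * 4.
  by rewrite ler_wpM2l //; have := sqr_ge0 th; move: th0; lra.
have le3 : th ^+ 2 <= 25^-1 * th by rewrite expr2 ler_pM2r.
move: le1 le2 le3 th0; lra.
Qed.

End BirthDeath.

(** * Total variation and reflection *)

Section TotalVariation.
Variables (R : realType) (N : nat).
Implicit Types (mu nu : 'rV[R]_N.+1) (P : 'M[R]_N.+1) (pi : 'rV[R]_N.+1).

Lemma tv_ge_test mu nu (f : 'I_N.+1 -> R) :
  distribution_on mu -> distribution_on nu -> (forall x, 0 <= f x <= 1) ->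
  \sum_x (mu 0 x - nu 0 x) * f x <= tv mu nu.
Proof.
move=> [_ mu1] [_ nu1] f01.
(* Recentring [f] at 1/2 bounds it by 1/2 in absolute value and yields the factor 1/2 of [tv]. *)
have -> : \sum_x (mu 0 x - nu 0 x) * f x =
          \sum_x (mu 0 x - nu 0 x) * (f x - 2^-1).
  under [RHS]eq_bigr do rewrite mulrBr.
  by rewrite [RHS]sumrB -mulr_suml sumrB mu1 nu1 subrr mul0r subr0.
rewrite /tv mulr_sumr; apply: ler_sum => x _.
apply: le_trans (ler_norm _) _; rewrite normrM mulrC ler_wpM2r //.
by have /andP[f0 f1] := f01 x; rewrite ler_norml; apply/andP; split; lra.
Qed.

(** Total variation is one minus the total overlap, of which a single state is kept. *)
Lemma tv_le_overlap mu nu x : distribution_on mu -> distribution_on nu ->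
  tv mu nu <= 1 - Num.min (mu 0 x) (nu 0 x).
Proof.
move=> [mu0 mu1] [nu0 nu1].
have -> : tv mu nu = 1 - \sum_y Num.min (mu 0 y) (nu 0 y).
  have -> : \sum_y Num.min (mu 0 y) (nu 0 y) =
      2^-1 * (\sum_y (mu 0 y + nu 0 y) - \sum_y `|mu 0 y - nu 0 y|).
    rewrite -sumrB mulr_sumr; apply: eq_bigr => y _.
    have [le_y|lt_y] := leP (mu 0 y) (nu 0 y).
      by rewrite ler0_norm ?subr_le0 //; field.
    by rewrite ger0_norm ?subr_ge0 ?(ltW lt_y) //; field.
  by rewrite big_split /= mu1 nu1 /tv; field.
rewrite lerD2l lerN2 (bigD1 x) //= lerDl.
by apply: sumr_ge0 => y _; rewrite le_min mu0 nu0.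
Qed.

Lemma le_dist_stat P pi t x : tv (row x (P ^+ t)) pi <= dist_stat P pi t.
Proof. exact: (le_bigmax_cond 0 (fun x => tv (row x (P ^+ t)) pi)). Qed.

Lemma dist_stat_le P pi t c : 0 <= c ->
  (forall x, tv (row x (P ^+ t)) pi <= c) -> dist_stat P pi t <= c.
Proof. by move=> c0 le_c; apply: bigmax_le. Qed.

(** The witness is the sign of the signed measure, centred so that the contraction applies; centring
    raises the sup bound from 1 to 2. *)
Lemma tv_dual P pi t x : stochastic P -> distribution_on pi ->
  exists h : 'I_N.+1 -> R, [/\ \sum_y pi 0 y * h y = 0, forall y, `|h y| <= 2 &
    2 * tv (row x (P ^+ t)) pi = `|iter t (avg P) h x|].
Proof.
move=> Pst [pi0 pi1]; pose f y := Num.sg ((P ^+ t) x y - pi 0 y).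
pose m := \sum_y pi 0 y * f y.
have f1 y : `|f y| <= 1 by rewrite normr_sg lern1 leq_b1.
have m1 : `|m| <= 1.
  apply: le_trans (ler_norm_sum _ _ _) _; rewrite -pi1; apply: ler_sum => y _.
  by rewrite normrM ger0_norm // -[leRHS]mulr1 ler_wpM2l.
exists (fun y => f y - m); split=> [|y|].
- under eq_bigr do rewrite mulrBr.
  by rewrite sumrB -mulr_suml pi1 mul1r subrr.
- by rewrite (le_trans (ler_normB _ _)) // (_ : 2 = 1 + 1) ?lerD.
have row1 : \sum_y (P ^+ t) x y = 1 by exact: (stoch_sum1 (stochasticX Pst t)).
rewrite iter_avgE.
have -> : \sum_y (P ^+ t) x y * (f y - m) = \sum_y `|(P ^+ t) x y - pi 0 y|.
  under eq_bigr do rewrite mulrBr.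
  rewrite sumrB -mulr_suml row1 mul1r /m -sumrB; apply: eq_bigr => y _.
  by rewrite -mulrBl mulrC -normrEsg.
rewrite ger0_norm ?sumr_ge0 // /tv mulrA divff ?mul1r //.
by apply: eq_bigr => y _; rewrite mxE.
Qed.

End TotalVariation.

Section Reflection.
Variables (R : realType) (N : nat).
Implicit Types (P : 'M[R]_N.+1) (pi : 'rV[R]_N.+1) (f : 'I_N.+1 -> R).

Definition rev_mx P : 'M[R]_N.+1 := \matrix_(x, y) P (rev_ord x) (rev_ord y).
Definition rev_row pi : 'rV[R]_N.+1 := \row_x pi 0 (rev_ord x).

Lemma sum_rev_ord f : \sum_x f (rev_ord x) = \sum_x f x.
Proof. by rewrite [RHS](reindex_inj rev_ord_inj). Qed.

Lemma avg_rev P f x : avg (rev_mx P) f x = avg P (f \o @rev_ord _) (rev_ord x).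
Proof.
rewrite /avg -[RHS]sum_rev_ord; apply: eq_bigr => y _.
by rewrite mxE /= rev_ordK.
Qed.

Lemma iter_avg_rev P f t x :
  iter t (avg (rev_mx P)) f x = iter t (avg P) (f \o @rev_ord _) (rev_ord x).
Proof.
elim: t x => [|t IH] x /=; first by rewrite rev_ordK.
by rewrite avg_rev; apply: eq_bigr => y _ /=; rewrite IH rev_ordK.
Qed.

Lemma tv_rev P pi t x :
  tv (row x (rev_mx P ^+ t)) (rev_row pi) = tv (row (rev_ord x) (P ^+ t)) pi.
Proof.
rewrite /tv -[in RHS]sum_rev_ord; congr (_ * _); apply: eq_bigr => y _.
rewrite !mxE; congr (`|_ - _|).
pose e (z w : 'I_N.+1) : R := (z == w)%:R.
have entry Q (z w : 'I_N.+1) : Q z w = \sum_v Q z v * e w v.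
  rewrite (bigD1 w) //= /e eqxx mulr1 big1 ?addr0 // => v vw.
  by rewrite eq_sym (negbTE vw) mulr0.
rewrite [LHS]entry [RHS]entry -!iter_avgE iter_avg_rev.
congr (iter _ _ _ _); apply/funext => v.
by rewrite /e /= -(inj_eq rev_ord_inj) rev_ordK.
Qed.

(** The record asks for upward edges only; their mirror images are downward edges, positive by
    detailed balance. *)
Lemma reversible_bd_rev P pi T :
  reversible_bd P pi T -> reversible_bd (rev_mx P) (rev_row pi) T.
Proof.
move=> H; split.
- move=> x; split=> [y|]; first by rewrite !mxE (stoch_ge0 (rbd_stoch H)).
  rewrite -(stoch_sum1 (rbd_stoch H) (rev_ord x)) -[RHS]sum_rev_ord.
  by apply: eq_bigr => y _; rewrite !mxE.
- move=> x y xy; rewrite mxE (rbd_near H) //=.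
  by have := ltn_ord x; have := ltn_ord y; lia.
- by move=> x; rewrite mxE (rbd_pos H).
- rewrite -(rbd_sum H) -[RHS]sum_rev_ord.
  by apply: eq_bigr => x _; rewrite mxE.
- by move=> x y; rewrite !mxE (rbd_bal H).
- move=> x y yx; rewrite mxE.
  have := rbd_bal H (rev_ord y) (rev_ord x) => bal.
  have edge : 0 < P (rev_ord y) (rev_ord x).
    by apply: (rbd_edge H); have := ltn_ord x; have := ltn_ord y; rewrite /=; lia.
  by rewrite -(pmulr_rgt0 _ (rbd_pos H (rev_ord x))) -bal mulr_gt0 ?(rbd_pos H).
- exact: rbd_T H.
- move=> h h0; pose g := h \o @rev_ord _.
  have g0 : \sum_x pi 0 x * g x = 0.
    apply: etrans h0; rewrite -[LHS]sum_rev_ord; apply: eq_bigr => x _.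
    by rewrite mxE /g /= rev_ordK.
  have := rbd_contr H g0.
  rewrite -[X in X <= _]sum_rev_ord -[X in _ * X]sum_rev_ord.
  congr (_ <= _ * _); apply: eq_bigr => x _; rewrite !mxE ?avg_rev //.
  by rewrite /g /= rev_ordK.
Qed.

(** Lower and upper [eps]-quantiles. The last two inequalities are not strict: reflection exchanges
    them with the two lower bounds, so strict ones would not be preserved. *)
Definition bulk pi (eps : R) (a b : nat) : Prop :=
  [/\ (a <= b <= N)%N, eps <= cdf pi a, 1 - eps <= cdf pi b,
      (forall k, (k < a)%N -> cdf pi k <= eps) &
      (forall k, (k < b)%N -> cdf pi k <= 1 - eps)].

Lemma cdf_rev pi k : \sum_x pi 0 x = 1 -> (k < N)%N ->
  cdf (rev_row pi) k = 1 - cdf pi (N - k.+1).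
Proof.
move=> pi1 kN; rewrite -pi1 (bigID (fun x : 'I_N.+1 => (x <= N - k.+1)%N)) /=.
rewrite addrAC subrr add0r /cdf [LHS]big_mkcond [RHS]big_mkcond -[RHS]sum_rev_ord.
apply: eq_bigr => x _; rewrite mxE /= subSS; have := ltn_ord x.
by case: ifP; case: ifP => //; lia.
Qed.

Lemma cdf_top pi k : \sum_x pi 0 x = 1 -> (N <= k)%N -> cdf pi k = 1.
Proof.
move=> <- Nk; apply: eq_bigl => x.
by apply: leq_trans Nk; rewrite -ltnS.
Qed.

Lemma le_cdf pi k l : (forall x, 0 <= pi 0 x) -> (k <= l)%N ->
  cdf pi k <= cdf pi l.
Proof.
move=> pi0 kl; rewrite /cdf [leLHS]big_mkcond [leRHS]big_mkcond /=.
apply: ler_sum => x _; case: ifP => xk; last by case: ifP.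
by rewrite (leq_trans xk kl).
Qed.

Lemma bulk_rev pi eps a b : distribution_on pi -> 0 <= eps <= 1 ->
  bulk pi eps a b -> bulk (rev_row pi) eps (N - b) (N - a).
Proof.
move=> [pi0 pi1] /andP[eps0 eps1] [/andP[ab bN] ca cb la lb].
have rpi1 : \sum_x rev_row pi 0 x = 1.
  by rewrite -pi1 -[RHS]sum_rev_ord; apply: eq_bigr => x _; rewrite mxE.
split.
- by rewrite leq_sub2l //= leq_subr.
- case: b {cb} ab bN lb => [|b] ab bN lb; first by rewrite cdf_top // subn0.
  rewrite cdf_rev //; last by lia.
  have := lb b (ltnSn b); have -> : (N - (N - b.+1).+1 = b)%N by lia.
  by lra.
- case: a {ca} ab la => [|a] ab la; first by rewrite subn0 cdf_top // gerBl.
  rewrite cdf_rev //; last by lia.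
  have := la a (ltnSn a); have -> : (N - (N - a.+1).+1 = a)%N by lia.
  by lra.
- move=> k kb; rewrite cdf_rev //; last by lia.
  have : cdf pi b <= cdf pi (N - k.+1) by apply: le_cdf => //; lia.
  by lra.
- move=> k ka; rewrite cdf_rev //; last by lia.
  have : cdf pi a <= cdf pi (N - k.+1) by apply: le_cdf => //; lia.
  by lra.
Qed.

End Reflection.

(** * From hitting times to two-sided bounds on the distance to stationarity *)

Section Window.
Variables (R : realType) (N : nat).
Implicit Types (P : 'M[R]_N.+1) (pi : 'rV[R]_N.+1).

Lemma bulk_exists pi eps : distribution_on pi -> 0 < eps <= 2^-1 ->
  exists a b, bulk pi eps a b.
Proof.
move=> [pi0 pi1] /andP[eps0 eps2].
have exa : exists k, eps <= cdf pi k by exists N; rewrite cdf_top //; lra.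
have exb : exists k, 1 - eps <= cdf pi k by exists N; rewrite cdf_top //; lra.
exists (ex_minn exa), (ex_minn exb).
case: ex_minnP => a ca amin; case: ex_minnP => b cb bmin; split => //.
- apply/andP; split; first by apply: amin; apply: le_trans cb; lra.
  by apply: bmin; rewrite cdf_top //; lra.
- move=> k; apply: contraTT; rewrite -ltNge -leqNgt => /ltW; exact: amin.
- move=> k; apply: contraTT; rewrite -ltNge -leqNgt => /ltW; exact: bmin.
Qed.

Lemma bulk_below pi eps a b : 0 <= eps -> bulk pi eps a b ->
  \sum_(x < N.+1 | (x < a)%N) pi 0 x <= eps.
Proof.
move=> eps0 [_ _ _ la _]; case: a la => [|a] la; first by rewrite big_pred0.
exact: la.
Qed.

Lemma bulk_mass pi eps a b : 0 <= eps -> bulk pi eps a b ->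
  1 - 2 * eps <= \sum_(x < N.+1 | (a <= x <= b)%N) pi 0 x.
Proof.
move=> eps0 B; have := bulk_below eps0 B; case: B => [/andP[ab _] _ cb _ _].
have cdfE : cdf pi b = \sum_(x < N.+1 | (x < a)%N) pi 0 x +
    \sum_(x < N.+1 | (a <= x <= b)%N) pi 0 x.
  rewrite /cdf (bigID (fun x : 'I_N.+1 => (x < a)%N)) /=; congr (_ + _);
    by apply: eq_bigl => x; lia.
by move: cb; rewrite cdfE; lra.
Qed.

(** Here [u] is the burn-in and [n] the time allowed for hitting [z]. Twice the variance bound is at
    most [4 T M / eps], and the last hypothesis makes Chebyshev's error at most [eps], on top of the
    [eps] inherited from [z]. *)
Lemma hitting_upper_bound P pi T (H : reversible_bd P pi T) eps a b h u n M
    (z x : 'I_N.+1) :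
  0 < eps -> bulk pi eps a b -> (z <= b)%N -> (x <= z)%N ->
  (forall y, `|h y| <= 2) ->
  (forall t, (u <= t <= n + u)%N -> `|iter t (avg P) h z| <= eps) ->
  hmean P pi b 0 <= M -> M < n%:R -> 4 * T * M <= eps ^+ 2 * (n%:R - M) ^+ 2 ->
  `|iter (n + u) (avg P) h x| <= 2 * eps.
Proof.
move=> eps0 [/andP[ab bN] _ _ _ lb] zb xz h2 hz bM Mn TM.
have T0 := rbd_T_gt0 H.
have fM : hmean P pi z x <= M by apply: le_trans bM; exact: hmean_mono H _ _ _ zb.
have fn : hmean P pi z x <= n%:R by exact: le_trans fM (ltW Mn).
have := hitting_upper_tail H (ltW eps0) h2 hz xz fn.
have lz k : (k < z)%N -> cdf pi k <= 1 - eps by move=> kz; apply: lb; lia.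
have := hvar_le H x (leq_trans zb bN) eps0 lz.
set q := `|_|; set v := hvar _ _ _ _; set f := hmean P pi z x in fM fn *.
move=> vf qv; rewrite leNgt; apply/negP => q2.
have sq : (n%:R - M) ^+ 2 <= (n%:R - f) ^+ 2.
  by rewrite ler_sqr ?nnegrE ?subr_ge0 ?(ltW Mn) // lerD2l lerN2.
have nM0 : 0 < (n%:R - M) ^+ 2 by rewrite exprn_gt0 // subr_gt0.
have lt1 : eps * (n%:R - M) ^+ 2 < (q - eps) * (n%:R - f) ^+ 2.
  apply: (@lt_le_trans _ _ ((q - eps) * (n%:R - M) ^+ 2)).
    by rewrite ltr_pM2r //; move: q2; lra.
  by apply: ler_wpM2l => //; move: q2 eps0; lra.
have le2 : v <= 2 * T / eps * M.
  by apply: le_trans vf _; rewrite ler_wpM2l // divr_ge0 ?mulr_ge0 ?ltW.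
have le3 : 2 * (2 * T / eps * M) <= eps * (n%:R - M) ^+ 2.
  rewrite -(ler_pM2l eps0) [leRHS]mulrA -expr2.
  by rewrite (_ : eps * _ = 4 * T * M) //; field; rewrite gt_eqF.
by move: lt1 qv le2 le3; lra.
Qed.

Lemma tv_upper_bound P pi T (H : reversible_bd P pi T) eps a b u n M :
  0 < eps <= 4^-1 -> bulk pi eps a b ->
  T <= (eps ^+ 2 / 25) ^+ 2 * u.+1%:R ->
  hmean P pi b 0 <= M -> hmean (rev_mx P) (rev_row pi) (N - a) 0 <= M ->
  M < n%:R -> 4 * T * M <= eps ^+ 2 * (n%:R - M) ^+ 2 ->
  dist_stat P pi (n + u) <= eps.
Proof.
move=> /andP[eps0 eps4] B Tu M1 M2 Mn TM; apply: dist_stat_le (ltW eps0) _ => x.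
have pi_dist : distribution_on pi.
  by split; [move=> y; exact/ltW/(rbd_pos H) | exact: rbd_sum H].
have eps01 : 0 < eps <= 1 by apply/andP; split => //; lra.
have [h [h0 h2 tvE]] := tv_dual (n + u) x (rbd_stoch H) pi_dist.
have mass : 2^-1 <= \sum_(y < N.+1 | (a <= y <= b)%N) pi 0 y.
  by apply: le_trans (bulk_mass (ltW eps0) B); lra.
have [z /andP[az zb] hz] := good_point H n h0 h2 eps01 Tu mass.
suff : `|iter (n + u) (avg P) h x| <= 2 * eps by rewrite -tvE ler_pM2l.
have [xz|/ltnW zx] := leqP x z.
  exact: (hitting_upper_bound H eps0 B zb xz h2 hz M1 Mn TM).
have Brev : bulk (rev_row pi) eps (N - b) (N - a).
  by apply: bulk_rev => //; apply/andP; split; lra.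
have rr : (h \o @rev_ord _) \o @rev_ord _ = h by apply/funext => y /=; rewrite rev_ordK.
have -> : x = rev_ord (rev_ord x) by rewrite rev_ordK.
rewrite -rr -iter_avg_rev.
apply: (hitting_upper_bound (reversible_bd_rev H) eps0 Brev (z := rev_ord z)) M2 Mn TM.
- by rewrite /= subSS leq_sub2l.
- by rewrite /= !subSS leq_sub2l.
- by move=> y; exact: h2.
- by move=> t tu; rewrite iter_avg_rev rev_ordK rr; exact: hz.
Qed.

(** The test set is the states below [a]: it has mass at most [eps] under [pi], while from 0 the
    chain has left it at time [t] with probability at most [eps / 2]. The term [2 * T / eps] pays
    for replacing [a] by [b], whose hitting time governs the upper bound. *)
Lemma tv_lower_bound P pi T (H : reversible_bd P pi T) eps a b t :
  0 < eps -> bulk pi eps a b ->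
  t%:R <= hmean P pi b 0 - 2 * T / eps - 2 / eps * Num.sqrt (T * hmean P pi b 0) ->
  exists x, 1 - 2 * eps < tv (row x (P ^+ t)) pi.
Proof.
move=> eps0 B; have Bb := bulk_below (ltW eps0) B.
case: B => [/andP[ab bN] ca _ _ lb]; set M := hmean P pi b 0.
have T0 := rbd_T_gt0 H.
have := hmean_resistance H ab bN eps0 ca lb; rewrite -/M.
set m := hmean P pi a 0 => Mm tM.
have M0 : 0 <= M by exact: hmean_ge0 H _ _.
have s0 : 0 <= 2 / eps * Num.sqrt (T * M).
  by rewrite mulr_ge0 ?sqrtr_ge0 // divr_ge0 // ltW.
have Mgt0 : 0 < M.
  have : (0 : R) <= t%:R by [].
  have : 0 < 2 * T / eps by rewrite divr_gt0 ?mulr_gt0.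
  by move: tM s0; lra.
have mM : m <= M by exact: hmean_mono H _ _ _ ab.
have tm : t%:R <= m by move: tM Mm s0; lra.
have := hitting_lower_tail H (x := ord0) (leq_trans ab bN) tm.
set I := iter _ _ _ _; rewrite -/m => low.
have la k : (k < a)%N -> cdf pi k <= 1 - eps.
  by move=> ka; apply: lb; exact: leq_trans ka ab.
have := hvar_le H 0 (leq_trans ab bN) eps0 la; rewrite -/m => vm.
have I2 : I <= eps / 2.
  have TM0 : 0 < T * M by rewrite mulr_gt0.
  have sq : 4 / eps ^+ 2 * (T * M) <= (m - t%:R) ^+ 2.
    have -> : 4 / eps ^+ 2 * (T * M) = (2 / eps * Num.sqrt (T * M)) ^+ 2.
      by rewrite exprMn sqr_sqrtr ?ltW // exprMn exprVn; congr (_ * _ * _); ring.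
    by rewrite ler_sqr ?nnegrE ?subr_ge0 //; move: tM Mm; lra.
  have [I0|I0] := leP I 0; first by apply: le_trans I0 _; rewrite divr_ge0 ?ltW.
  have := ler_wpM2r (ltW I0) sq.
  have vM : 2 * T / eps * m <= 2 * T / eps * M.
    by rewrite ler_wpM2l // divr_ge0 ?mulr_ge0 ?ltW.
  move=> le1; have le2 : 4 / eps ^+ 2 * (T * M) * I <= 2 * T / eps * M.
    by move: le1 low vm vM; rewrite /= ; lra.
  have c0 : 0 < 4 / eps ^+ 2 * (T * M) by rewrite mulr_gt0 ?divr_gt0 ?exprn_gt0.
  rewrite -(ler_pM2l c0); apply: le_trans le2 _.
  by rewrite le_eqVlt; apply/orP; left; apply/eqP; field; rewrite gt_eqF.
exists ord0; pose f (y : 'I_N.+1) : R := (y < a)%:R.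
have pi_dist : distribution_on pi.
  by split; [move=> y; exact/ltW/(rbd_pos H) | exact: rbd_sum H].
have f01 y : 0 <= f y <= 1 by rewrite /f ler0n lern1 leq_b1.
apply: lt_le_trans (tv_ge_test (stochasticX (rbd_stoch H) t ord0) pi_dist f01).
have -> : \sum_y (row ord0 (P ^+ t) 0 y - pi 0 y) * f y =
    1 - I - \sum_(y < N.+1 | (y < a)%N) pi 0 y.
  under eq_bigr do rewrite mxE mulrBl.
  rewrite sumrB; congr (_ - _); last first.
    rewrite [RHS]big_mkcond; apply: eq_bigr => y _; rewrite /f.
    by case: ifP; rewrite ?mulr1 ?mulr0.
  rewrite /I iter_avgE -[X in X - _](stoch_sum1 (stochasticX (rbd_stoch H) t) ord0) -sumrB.
  apply: eq_bigr => y _; rewrite /f ltnNge.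
  by case: (a <= y)%N; rewrite ?mulr1 ?mulr0 ?subrr ?subr0.
by move: Bb I2 eps0; lra.
Qed.

Lemma mixing_window P pi T (H : reversible_bd P pi T) eps : 0 < eps <= 4^-1 ->
  let c := (25 / eps ^+ 2) ^+ 2 + 1 in
  exists2 M : R, 0 <= M &
    (forall t : nat, M + 2 / eps * Num.sqrt (T * M) + c * T <= t%:R ->
      dist_stat P pi t <= eps) /\
    (forall t : nat, t%:R <= M - 2 * T / eps - 2 / eps * Num.sqrt (T * M) ->
      1 - 2 * eps < dist_stat P pi t).
Proof.
move=> eps04 c; case/andP: (eps04) => eps0 eps4.
have pi_dist : distribution_on pi.
  by split; [move=> y; exact/ltW/(rbd_pos H) | exact: rbd_sum H].
have [|a [b B]] := bulk_exists (eps := eps) pi_dist; first by apply/andP; split; lra.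
have T0 := rbd_T_gt0 H; have Hr := reversible_bd_rev H.
have Brev : bulk (rev_row pi) eps (N - b) (N - a).
  by apply: bulk_rev => //; apply/andP; split; lra.
pose M1 := hmean P pi b 0; pose M2 := hmean (rev_mx P) (rev_row pi) (N - a) 0.
have M10 : 0 <= M1 by exact: hmean_ge0 H _ _.
exists (Num.max M1 M2); first by rewrite le_max M10.
have le1 : M1 <= Num.max M1 M2 by rewrite le_max lexx.
have le2 : M2 <= Num.max M1 M2 by rewrite le_max lexx orbT.
split=> t.
  set M := Num.max M1 M2 in le1 le2 *; set s := 2 / eps * Num.sqrt (T * M) => ht.
  have M0 : 0 <= M by exact: le_trans le1.
  have s0 : 0 <= s by rewrite mulr_ge0 ?sqrtr_ge0 // divr_ge0 // ltW.
  (* The reciprocal of the constant in [good_point], so that [u] is a sufficient burn-in; the extra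
     [T] in [c * T] gives the strict inequality [M < n]. *)
  pose K := (25 / eps ^+ 2) ^+ 2.
  have KT0 : 0 <= K * T by rewrite mulr_ge0 ?(ltW T0) ?sqr_ge0.
  pose u := Num.truncn (K * T).
  have /andP[uK Ku] := truncn_itv KT0.
  have ut : (u <= t)%N.
    rewrite -(ler_nat R) (le_trans uK) // (le_trans _ ht) //.
    by rewrite /c -/K mulrDl mul1r; lra.
  rewrite -(subnK ut); apply: (tv_upper_bound H eps04 B _ le1 le2).
  - rewrite -(ler_pM2l (_ : 0 < K)); last by rewrite exprn_gt0 // divr_gt0 ?exprn_gt0.
    apply: le_trans (ltW Ku) _; rewrite mulrA.
    have -> : K * (eps ^+ 2 / 25) ^+ 2 = 1 by rewrite /K; field; rewrite gt_eqF.
    by rewrite mul1r.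
  - rewrite natrB //; have T1 := rbd_T H.
    by move: ht uK s0; rewrite /c -/K mulrDl mul1r -/u; lra.
  - have : s <= (t - u)%:R - M.
      rewrite natrB //; have T1 := rbd_T H.
      by move: ht uK s0; rewrite /c -/K mulrDl mul1r -/u; lra.
    move=> sle; apply: (@le_trans _ _ (eps ^+ 2 * s ^+ 2)); last first.
      by rewrite ler_wpM2l ?sqr_ge0 // ler_sqr ?nnegrE // (le_trans s0).
    rewrite /s exprMn sqr_sqrtr ?mulr_ge0 // ?(ltW T0) //.
    by rewrite le_eqVlt; apply/orP; left; apply/eqP; field; rewrite gt_eqF.
(* The end attaining the maximum is a slow starting point, directly or after reflection. *)
case: (leP M1 M2) => _ ht.
  have [x] := tv_lower_bound Hr eps0 Brev ht.
  by rewrite tv_rev => lt_x; apply: lt_le_trans lt_x (le_dist_stat _ _ _ _).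
have [x lt_x] := tv_lower_bound H eps0 B ht.
exact: lt_le_trans lt_x (le_dist_stat _ _ _ _).
Qed.

End Window.

(** * Spectral gap *)

Section SymmetricSpectrum.
Variables (R : realType) (n : nat).
Local Notation C := R[i]%C.
Local Notation "x %:C" := (real_complex R x).
Local Notation "M ^t*" := (map_mx Num.conj (M^T)) (at level 30).

Lemma sum_sqr_norm_rV (X : 'rV[C]_n) :
  (X *m X ^t*) 0 0 = \sum_i `|X 0 i| ^+ 2.
Proof. by rewrite mxE; apply: eq_bigr => i _; rewrite !mxE -normCK. Qed.

Lemma conj_real_complex (x : R) : Num.conj x%:C = x%:C.
Proof. by apply/eqP; rewrite -CrealE complex_real. Qed.

Lemma norm_real_complex (x : R) : `|x%:C| = `|x|%:C.
Proof. by rewrite normc_def /= expr0n addr0 sqrtr_sqr. Qed.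

(** Parseval in an orthonormal eigenbasis. The alternative in the hypothesis excuses eigenvectors
    orthogonal to [v], which will dispose of the eigenvalue 1. *)
Lemma symmetric_contraction (M : 'M[R]_n) (v : 'rV[R]_n) (l : R) :
  M^T = M -> 0 <= l ->
  (forall (u : 'rV[C]_n) (d : C), u != 0 ->
     u *m map_mx (real_complex R) M = d *: u ->
     \sum_x u 0 x * (v 0 x)%:C = 0 \/ `|d| <= l%:C) ->
  \sum_x (v *m M) 0 x ^+ 2 <= l ^+ 2 * \sum_x v 0 x ^+ 2.
Proof.
move=> Msym l0 bound; set Mc := map_mx (real_complex R) M.
pose vc := map_mx (real_complex R) v.
have Mnormal : Mc \is normalmx.
  apply/hermitian_normalmx/realsym_hermsym.
    apply/is_hermitianmxP/matrixP => i j.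
    by rewrite expr0 scale1r !mxE -[in LHS]Msym mxE.
  by apply/mxOverP => i j; rewrite mxE complex_real.
pose U := spectralmx Mc; pose D := spectral_diag Mc.
have Uu : U \is unitarymx := spectral_unitarymx Mc.
have UU : U *m U ^t* = 1%:M by apply/unitarymxP.
have UU' : U ^t* *m U = 1%:M by exact: mulmx1C.
have McE : Mc = U ^t* *m diag_mx D *m U.
  by rewrite -(invmx_unitary Uu); have /orthomx_spectralP := Mnormal.
pose w := vc *m U ^t*.
have vE : vc = w *m U by rewrite -mulmxA UU' mulmx1.
have normU (X : 'rV[C]_n) : \sum_i `|(X *m U) 0 i| ^+ 2 = \sum_i `|X 0 i| ^+ 2.
  rewrite -!sum_sqr_norm_rV trmx_mul map_mxM mulmxA -[X *m U *m _]mulmxA UU.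
  by rewrite mulmx1.
have normR (X : 'rV[R]_n) : (\sum_i X 0 i ^+ 2)%:C =
    \sum_i `|map_mx (real_complex R) X 0 i| ^+ 2.
  rewrite rmorph_sum; apply: eq_bigr => i _; rewrite mxE norm_real_complex.
  by rewrite -[X in X = _]/(real_complex R _) -rmorphXn real_normK ?num_real.
rewrite -lecR rmorphM /= !normR map_mxM -/Mc -/vc {1}vE McE.
rewrite !mulmxA -[w *m U *m _]mulmxA UU mulmx1 normU vE normU mulr_sumr.
apply: ler_sum => i _; rewrite mul_mx_diag mxE normrM exprMn.
have row_eigen : row i U *m Mc = D 0 i *: row i U.
  by rewrite McE -row_mul !mulmxA UU mul1mx row_mul row_diag_mx -scalemxAl -rowE.
have row_neq0 : row i U != 0.
  apply/eqP => Ui0; have := row_mul i U (U ^t*).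
  rewrite UU Ui0 mul0mx => /rowP/(_ i); rewrite !mxE eqxx => /eqP.
  by rewrite oner_eq0.
have [dot0|le_l] := bound _ _ row_neq0 row_eigen.
  have -> : w 0 i = 0.
    apply/eqP; rewrite -conjC_eq0 -[X in _ == X]dot0 mxE rmorph_sum /=.
    apply/eqP; apply: eq_bigr => x _.
    by rewrite !mxE rmorphM /= conjCK conj_real_complex mulrC.
  by rewrite normr0 expr0n mul0r mulr0.
rewrite [leRHS]mulrC; apply: ler_wpM2l; first by rewrite exprn_ge0.
by rewrite rmorphXn ler_pXn2r ?nnegrE ?normr_ge0 ?ler0c.
Qed.
End SymmetricSpectrum.

Section ZeroSum.
Variables (R : realType) (N : nat).
Local Notation C := R[i]%C.
Local Notation "x %:C" := (real_complex R x).

(* As [v] sums to [0], [alpha] can be subtracted from all entries of [A]. *)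
Lemma doeblin_contraction (A : 'M[R]_N.+1) (v : 'rV[R]_N.+1) (alpha : R) :
  (forall x y, alpha <= A x y) -> (forall x, \sum_y A x y = 1) ->
  \sum_x v 0 x = 0 ->
  \sum_y `|(v *m A) 0 y| <= (1 - alpha *+ N.+1) * \sum_x `|v 0 x|.
Proof.
move=> A_ge A_sum v0.
have E y : (v *m A) 0 y = \sum_x v 0 x * (A x y - alpha).
  under [RHS]eq_bigr do rewrite mulrBr.
  by rewrite sumrB -mulr_suml v0 mul0r subr0 mxE.
apply: (@le_trans _ _ (\sum_y \sum_x `|v 0 x| * (A x y - alpha))).
  apply: ler_sum => y _; rewrite E; apply: le_trans (ler_norm_sum _ _ _) _.
  by apply: ler_sum => x _; rewrite normrM [`|A x y - _|]ger0_norm // subr_ge0.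
rewrite exchange_big /= mulr_sumr; apply: ler_sum => x _.
by rewrite -mulr_sumr sumrB A_sum sumr_const card_ord mulrC.
Qed.

(** As [v] sums to 0, [pi] can be subtracted from every row of [P ^+ t]. Complex entries are allowed
    so that [v] may be an eigenvector. *)
Lemma tv_contraction (P : 'M[R]_N.+1) (pi : 'rV[R]_N.+1) (t : nat)
    (v : 'rV[C]_N.+1) : \sum_x v 0 x = 0 ->
  \sum_y `|(v *m map_mx (real_complex R) (P ^+ t)) 0 y| <=
  (2 * dist_stat P pi t)%:C * \sum_x `|v 0 x|.
Proof.
move=> v0.
have E y : (v *m map_mx (real_complex R) (P ^+ t)) 0 y =
    \sum_x v 0 x * ((P ^+ t) x y - pi 0 y)%:C.
  under [RHS]eq_bigr do rewrite rmorphB mulrBr.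
  rewrite sumrB -mulr_suml v0 mul0r subr0 mxE.
  by apply: eq_bigr => x _; rewrite mxE.
apply: (@le_trans _ _ (\sum_y \sum_x `|v 0 x| * `|(P ^+ t) x y - pi 0 y|%:C)).
  apply: ler_sum => y _; rewrite E; apply: le_trans (ler_norm_sum _ _ _) _.
  by apply: ler_sum => x _; rewrite normrM norm_real_complex.
rewrite exchange_big /= mulr_sumr; apply: ler_sum => x _.
rewrite -mulr_sumr mulrC; apply: ler_wpM2r => //; rewrite -rmorph_sum lecR.
have := le_dist_stat P pi t x; rewrite -(ler_pM2l (ltr0n R 2)) /tv mulrA.
rewrite divff // mul1r; apply: le_trans; rewrite le_eqVlt; apply/orP; left.
by apply/eqP; apply: eq_bigr => y _; rewrite mxE.
Qed.

End ZeroSum.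

(** * Stationary law, reversibility and spectral gap of a lazy irreducible chain *)

Section Chain.
Variables (R : realType) (N : nat) (P : 'M[R]_N.+1) (pi : 'rV[R]_N.+1) (delta : R).
Hypotheses (delta_gt0 : 0 < delta) (P_bd : birth_death P) (P_lazy : lazy delta P)
  (P_irr : irreducible P) (pi_stat : stationary P pi).
Local Notation C := R[i]%C.
Local Notation "x %:C" := (real_complex R x).
Local Notation Pc := (map_mx (real_complex R) P).

Let P_stoch : stochastic P. Proof. by case: P_bd. Qed.

Lemma stationaryX t : pi *m P ^+ t = pi.
Proof.
elim: t => [|t IH]; first by rewrite expr0 mulmx1.
by rewrite exprSr mulmxA IH; case: pi_stat.
Qed.

Lemma lazyX s t x y : (P ^+ s) x y * delta ^+ t <= (P ^+ (s + t)) x y.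
Proof.
elim: t => [|t IH]; first by rewrite expr0 mulr1 addn0.
have Pge0 r z w : 0 <= (P ^+ r) z w := stoch_ge0 (stochasticX P_stoch r) z w.
rewrite addnS [P ^+ _.+1]exprSr mxE (bigD1 y) //= exprSr mulrA.
apply: (@le_trans _ _ ((P ^+ (s + t)) x y * P y y)).
  have d0 := ltW delta_gt0.
  by apply: ler_pM IH (P_lazy y) => //; rewrite mulr_ge0 ?exprn_ge0.
by rewrite lerDl sumr_ge0 // => z _; rewrite mulr_ge0 ?(stoch_ge0 P_stoch).
Qed.

Lemma lazy_diag t x : delta ^+ t <= (P ^+ t) x x.
Proof. by have := lazyX 0 t x x; rewrite expr0 mxE eqxx mul1r. Qed.

(** Laziness keeps a positive entry positive at all later times, so the sum of one time per pair
    serves all pairs. *)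
Lemma eventually_positive : exists t, forall x y, 0 < (P ^+ t) x y.
Proof.
have /choice[s sP] : forall p : 'I_N.+1 * 'I_N.+1, exists t, 0 < (P ^+ t) p.1 p.2.
  by move=> p; exact: P_irr.
exists (\sum_p s p)%N => x y; rewrite (bigD1 (x, y)) //=.
by apply: lt_le_trans (lazyX _ _ _ _); rewrite mulr_gt0 ?exprn_gt0 // (sP (x, y)).
Qed.

Lemma stat_gt0 x : 0 < pi 0 x.
Proof.
have [t tP] := eventually_positive; have [[pi0 pi1] _] := pi_stat.
rewrite -(stationaryX t) mxE lt_def sumr_ge0 ?andbT; last first.
  by move=> y _; rewrite mulr_ge0 // ltW.
apply/eqP => /psumr_eq0P E; move: pi1; rewrite big1 => [/eqP|y _].
  by rewrite eq_sym oner_eq0.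
have /eqP : pi 0 y * (P ^+ t) y x = 0.
  by apply: E => // z _; rewrite mulr_ge0 // ltW.
by rewrite mulf_eq0 [X in _ || X]gt_eqF // orbF => /eqP.
Qed.

(** Doeblin's argument in blocks of [s] steps with positive entries. It keeps [tmix] off its default
    value and yields the positive gap. *)
Lemma dist_stat_cvg0 (eps : R) : 0 < eps -> exists t, dist_stat P pi t <= eps.
Proof.
move=> eps0; have [s sP] := eventually_positive.
pose alpha := \big[Num.min/1]_(p : 'I_N.+1 * 'I_N.+1) (P ^+ s) p.1 p.2.
have alpha0 : 0 < alpha by apply/bigmin_gtP; split => // p _; exact: sP.
have alphaP x y : alpha <= (P ^+ s) x y.
  exact: (bigmin_le_cond 1 (fun p : 'I_N.+1 * 'I_N.+1 => (P ^+ s) p.1 p.2) (j := (x, y))).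
have sum1 := stoch_sum1 (stochasticX P_stoch s).
pose rho := 1 - alpha *+ N.+1.
have rho0 : 0 <= rho.
  rewrite subr_ge0 -(sum1 ord0) -[X in alpha *+ X](card_ord N.+1) -sumr_const.
  by apply: ler_sum => y _.
have rho1 : rho < 1 by rewrite gtrBl mulrn_wgt0.
have [k rhok] : exists k, rho ^+ k <= eps.
  have /cvgrPdist_le/(_ _ eps0)[k _ kP] : rho ^+ k @[k --> \oo] --> 0.
    by apply: cvg_expr; rewrite ger0_norm.
  by exists k; have := kP k (leqnn k); rewrite sub0r normrN ger0_norm // exprn_ge0.
exists (s * k)%N; apply: dist_stat_le (ltW eps0) _ => x.
have [[pi0 pi1] _] := pi_stat.
pose e : 'rV[R]_N.+1 := delta_mx 0 x.
have e1 : \sum_y e 0 y = 1.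
  rewrite (bigD1 x) //= mxE !eqxx big1 ?addr0 // => y yx.
  by rewrite mxE (negbTE yx) andbF.
have stepE j : (e - pi) *m P ^+ (s * j) = row x (P ^+ (s * j)) - pi.
  by rewrite mulmxBl stationaryX -rowE.
have norm_le j : \sum_y `|((e - pi) *m P ^+ (s * j)) 0 y| <= rho ^+ j * 2.
  elim: j => [|j IH].
    rewrite muln0 !expr0 mulmx1 mul1r.
    apply: (@le_trans _ _ (\sum_y (e 0 y + pi 0 y))).
      apply: ler_sum => y _; rewrite !mxE; apply: le_trans (ler_normB _ _) _.
      by rewrite !ger0_norm ?ler0n.
    by rewrite big_split /= e1 pi1.
  rewrite mulnS addnC exprD mulmxA exprS -mulrA.
  apply: le_trans (doeblin_contraction alphaP sum1 _) _.
    rewrite stepE; under eq_bigr do rewrite 2!mxE [(- pi) _ _]mxE.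
    by rewrite sumrB (stoch_sum1 (stochasticX P_stoch _)) pi1 subrr.
  by rewrite ler_wpM2l.
apply: le_trans rhok; rewrite /tv -(ler_pM2l (ltr0n R 2)) mulrA divff // mul1r mulrC.
apply: le_trans (norm_le k); rewrite stepE le_eqVlt; apply/orP; left.
by apply/eqP; apply: eq_bigr => y _; rewrite !mxE.
Qed.

Definition nontrivial_moduli : set R := [set r : R | exists z : C,
  [/\ eigenvalue Pc z, z != 1 & r%:C = `|z|]].

Lemma row_sum_Pc (v : 'rV[C]_N.+1) : \sum_y (v *m Pc) 0 y = \sum_x v 0 x.
Proof.
under eq_bigr do rewrite mxE.
rewrite exchange_big /=; apply: eq_bigr => x _; rewrite -mulr_sumr.
under eq_bigr do rewrite mxE.
by rewrite -rmorph_sum (stoch_sum1 P_stoch) rmorph1 mulr1.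
Qed.

(** [P] preserves the sum of a row vector, so a left eigenvector of eigenvalue other than 1 sums to
    0, and [tv_contraction] applies to it. *)
Lemma moduli_le_dist r t : nontrivial_moduli r ->
  0 <= r /\ r ^+ t <= 2 * dist_stat P pi t.
Proof.
move=> [z [/eigenvalueP[v vP v0] z1 rE]]; split; first by rewrite -ler0c rE.
have sum_v0 : \sum_x v 0 x = 0.
  apply/eqP; have := row_sum_Pc v; rewrite vP.
  under eq_bigr do rewrite mxE.
  rewrite -mulr_sumr => /eqP; rewrite -subr_eq0 -[X in _ - X]mul1r -mulrBl.
  by rewrite mulf_eq0 subr_eq0 (negbTE z1).
have vX : v *m map_mx (real_complex R) (P ^+ t) = z ^+ t *: v.
  elim: t => [|t IH]; first by rewrite !expr0 -idmxE map_mx1 mulmx1 scale1r.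
  by rewrite exprS -mulmxE map_mxM mulmxA vP -scalemxAl IH scalerA -exprS.
have norm_v : 0 < \sum_x `|v 0 x|.
  rewrite lt_def sumr_ge0 // andbT; apply: contraNneq v0 => /psumr_eq0P E.
  by apply/eqP/rowP => x; rewrite mxE; apply: normr0_eq0; apply: E.
have := tv_contraction P pi t sum_v0; rewrite vX.
under eq_bigr do rewrite mxE normrM normrX -rE.
by rewrite -mulr_sumr ler_pM2r // -rmorphXn lecR.
Qed.

(** Since [lambda] is a supremum, a uniform bound is needed. One time with [d <= 1/4] gives
    [r ^+ t <= 1/2] for all moduli, and Bernoulli's inequality turns this into [r <= 1 - beta]. *)
Lemma moduli_lt1 : exists2 beta, 0 < beta & ubound nontrivial_moduli (1 - beta).
Proof.
have [|t tP] := dist_stat_cvg0 (eps := 4^-1); first by rewrite invr_gt0.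
pose beta : R := (2 * t.+1%:R)^-1.
have t1 : (1 : R) <= t.+1%:R by rewrite ler1n.
have beta0 : 0 < beta by rewrite invr_gt0 mulr_gt0.
have bt : t.+1%:R * beta = 2^-1 by rewrite /beta; field; rewrite gt_eqF // ltr0n.
exists beta => // r rM; have [r0 rt] := moduli_le_dist t rM.
have beta1 : beta <= 2^-1 by rewrite -bt ler_peMl // ltW.
rewrite leNgt; apply/negP => lt_r.
have bernoulli k : 1 - k%:R * beta <= (1 - beta) ^+ k.
  elim: k => [|k IH]; first by rewrite mul0r subr0.
  rewrite exprS -natr1; apply: le_trans (ler_wpM2l _ IH); last by lra.
  have : 0 <= k%:R * beta ^+ 2 by rewrite mulr_ge0 ?sqr_ge0.
  by rewrite expr2; lra.
have tb : t%:R * beta < 2^-1 by rewrite -bt -natr1; lra.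
have : (1 - beta) ^+ t <= r ^+ t by apply: lerXn2r; rewrite ?nnegrE //; lra.
by have := bernoulli t; move: rt tP; lra.
Qed.

Lemma lambda_ub r : nontrivial_moduli r -> r <= lambda P.
Proof.
move=> rM; have [beta _ ubM] := moduli_lt1.
by apply: ub_le_sup => //; exists (1 - beta).
Qed.

Lemma lambda_ge0 : 0 <= lambda P.
Proof.
have [E|/set0P[r rM]] := eqVneq nontrivial_moduli set0.
  by rewrite /lambda -/nontrivial_moduli E sup0.
by apply: le_trans (lambda_ub rM); have [] := moduli_le_dist 0 rM.
Qed.

Lemma lambda_lt1 : lambda P < 1.
Proof.
have [beta beta0 ubM] := moduli_lt1.
have [E|ne] := eqVneq nontrivial_moduli set0.
  by rewrite /lambda -/nontrivial_moduli E sup0.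
apply: (@le_lt_trans _ _ (1 - beta)); last by rewrite gtrBl.
by apply: ge_sup => //; exact/set0P.
Qed.

Lemma gap_gt0 : 0 < gap P. Proof. by rewrite subr_gt0 lambda_lt1. Qed.

Lemma trel_ge1 : 1 <= trel P.
Proof. by rewrite /trel invf_ge1 ?gap_gt0 // gerBl lambda_ge0. Qed.

Lemma up_edge_gt0 (x y : 'I_N.+1) : y = x.+1 :> nat -> 0 < P x y.
Proof.
move=> yx; rewrite lt_def (stoch_ge0 P_stoch) andbT; apply/eqP => Pxy.
have [t] := P_irr x y.
suff blocked (u w : 'I_N.+1) : (u <= x)%N -> (x < w)%N -> (P ^+ t) u w = 0.
  by rewrite blocked ?ltxx // yx.
elim: t u => [|t IH] u ux xw.
  by rewrite expr0 mxE; case: eqP => // uw; move: xw; rewrite -uw ltnNge ux.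
rewrite exprS mxE big1 // => v _; have [vx|xv] := leqP v x.
  by rewrite (IH v vx xw) mulr0.
have [uvE|uv] := eqVneq (v : nat) u.+1; last first.
  by rewrite (P_bd.2 u v) ?mul0r //; lia.
have -> : u = x by apply: val_inj => /=; lia.
have -> : v = y by apply: val_inj => /=; lia.
by rewrite Pxy mul0r.
Qed.

(* The net flow across the cut between [k] and [k + 1] vanishes. *)
Lemma detailed_balance x y : pi 0 x * P x y = pi 0 y * P y x.
Proof.
have [_ piP] := pi_stat.
pose J x y := pi 0 y * P y x - pi 0 x * P x y.
have J_anti u w : J u w = - J w u by rewrite opprB.
have J_sum u : \sum_w J u w = 0.
  rewrite sumrB -mulr_sumr (stoch_sum1 P_stoch) mulr1.
  by have /rowP/(_ u) := piP; rewrite mxE => ->; rewrite subrr.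
suff up (u w : 'I_N.+1) : w = u.+1 :> nat -> J u w = 0.
  have [xy|nxy] := eqVneq (y : nat) x.+1.
    by apply/esym/eqP; rewrite -subr_eq0; apply/eqP/up.
  have [yx|nyx] := eqVneq (x : nat) y.+1.
    by apply/eqP; rewrite -subr_eq0; apply/eqP/up.
  have [->//|xNy] := eqVneq x y; move: xNy; rewrite -val_eqE /= => xNy.
  by rewrite (P_bd.2 x y) ?(P_bd.2 y x) ?mulr0 //; lia.
move=> wu; pose low (z : 'I_N.+1) := (z <= u)%N.
have : \sum_(z | low z) \sum_v J z v = 0 by apply: big1 => z _.
under eq_bigr => z _ do rewrite (bigID low) /=.
rewrite big_split /= [X in X + _ = 0](_ : _ = 0); last first.
  set S := \sum_(z | low z) _; suff : S = - S by lra.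
  rewrite {1}/S exchange_big /= -sumrN; apply: eq_bigr => z _.
  by rewrite -sumrN; apply: eq_bigr => v _; exact: J_anti.
have low_u : low u by exact: leqnn.
rewrite add0r (bigD1 u) //= [X in _ + X]big1 ?addr0; last first.
  move=> z /andP[zu nzu]; rewrite /low in zu; apply: big1 => v; rewrite /low -ltnNge => uv.
  move: nzu; rewrite -val_eqE /= => nzu.
  by rewrite /J (P_bd.2 z v) ?(P_bd.2 v z) ?mulr0 ?subrr //; lia.
have high_w : ~~ low w by rewrite /low wu ltnn.
rewrite (bigD1 w) //= big1 ?addr0 // => v /andP[]; rewrite /low -ltnNge => uv nvw.
move: nvw; rewrite -val_eqE /= => nvw.
by rewrite /J (P_bd.2 u v) ?(P_bd.2 v u) ?mulr0 ?subrr //; lia.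
Qed.

(** Simplicity of the eigenvalue 1: removing the multiple of [pi] with the same sum leaves a fixed
    vector of sum 0, whose norm is at most half itself. *)
Lemma fixed_row_prop (w : 'rV[C]_N.+1) : w *m Pc = w ->
  forall x, w 0 x = (\sum_y w 0 y) * (pi 0 x)%:C.
Proof.
move=> wP x; have [[pi0 pi1] piP] := pi_stat.
pose pic := map_mx (real_complex R) pi.
pose c := \sum_y w 0 y; pose v := w - c *: pic.
have vP : v *m Pc = v by rewrite mulmxBl wP -scalemxAl -map_mxM piP.
have v_sum0 : \sum_y v 0 y = 0.
  under eq_bigr do rewrite !mxE.
  by rewrite sumrB -mulr_sumr -rmorph_sum pi1 rmorph1 mulr1 subrr.
have [|t tP] := dist_stat_cvg0 (eps := 4^-1); first by rewrite invr_gt0.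
have vX : v *m map_mx (real_complex R) (P ^+ t) = v.
  elim: (t) => [|k IH]; first by rewrite expr0 -idmxE map_mx1 mulmx1.
  by rewrite exprS -mulmxE map_mxM mulmxA vP IH.
have := tv_contraction P pi t v_sum0; rewrite vX.
set n := \sum_y _ => n_le.
have n0 : 0 <= n by apply: sumr_ge0.
have n_eq0 : n = 0.
  apply: le_anti; rewrite n0 andbT.
  have : n <= (2^-1)%:C * n.
    by apply: le_trans n_le _; apply: ler_wpM2r => //; rewrite lecR; lra.
  rewrite fmorphV rmorph_nat -subr_ge0 -{2}[n]mul1r -mulrBl.
  rewrite (_ : 2^-1 - 1 = - 2^-1); last by field.
  by rewrite mulNr oppr_ge0 pmulr_rle0 // invr_gt0.
have /normr0_eq0/eqP := psumr_eq0P (fun y _ => normr_ge0 (v 0 y)) n_eq0 (i := x) isT.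
by rewrite !mxE subr_eq0 => /eqP.
Qed.

(** Conjugation by the square root of [pi] makes [P] symmetric by detailed balance. Eigenvectors for
    1 become multiples of that root, orthogonal to the image of a mean-zero [h]. *)
Lemma lambda_contraction (h : 'I_N.+1 -> R) : \sum_x pi 0 x * h x = 0 ->
  \sum_x pi 0 x * avg P h x ^+ 2 <= lambda P ^+ 2 * \sum_x pi 0 x * h x ^+ 2.
Proof.
move=> h0; pose s x := Num.sqrt (pi 0 x).
have s0 x : 0 < s x by rewrite sqrtr_gt0 stat_gt0.
have sN0 x : s x != 0 by rewrite gt_eqF.
have s2 x : s x ^+ 2 = pi 0 x by rewrite sqr_sqrtr // ltW // stat_gt0.
pose M : 'M[R]_N.+1 := \matrix_(x, y) (s x * P x y / s y).
pose v : 'rV[R]_N.+1 := \row_x (s x * h x).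
have Msym : M^T = M.
  apply/matrixP => x y; rewrite !mxE.
  apply/eqP; rewrite eqr_div //; apply/eqP.
  by rewrite mulrAC [RHS]mulrAC -!expr2 !s2 detailed_balance.
have vM x : (v *m M) 0 x = s x * avg P h x.
  rewrite -{1}Msym mxE /avg mulr_sumr; apply: eq_bigr => y _.
  by rewrite !mxE; field.
have -> : \sum_x pi 0 x * avg P h x ^+ 2 = \sum_x (v *m M) 0 x ^+ 2.
  by apply: eq_bigr => x _; rewrite vM exprMn s2.
have -> : \sum_x pi 0 x * h x ^+ 2 = \sum_x v 0 x ^+ 2.
  by apply: eq_bigr => x _; rewrite mxE exprMn s2.
apply: symmetric_contraction Msym lambda_ge0 _ => u d u0 uM.
pose w : 'rV[C]_N.+1 := \row_x (u 0 x * (s x)%:C).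
have wP : w *m Pc = d *: w.
  apply/rowP => y; have /rowP/(_ y) := uM; rewrite !mxE => E.
  rewrite [RHS]mulrA -E mulr_suml; apply: eq_bigr => x _.
  rewrite !mxE -!mulrA; congr (_ * _).
  by rewrite -!rmorphM; congr (real_complex R _); field.
have w0 : w != 0.
  apply: contraNneq u0 => /rowP w0; apply/eqP/rowP => x; have := w0 x.
  rewrite !mxE => /eqP; rewrite mulf_eq0 => /orP[/eqP->//|].
  by rewrite (_ : 0 = (0 : R)%:C) // (inj_eq (@complexI R)) (negbTE (sN0 x)).
have [d1|d1] := eqVneq d 1; last first.
  right; rewrite -[`|d|]RRe_real ?normr_real // lecR; apply: lambda_ub.
  exists d; split=> //.
  by apply/eigenvalueP; exists w.
left; have := fixed_row_prop (etrans wP _) => wE.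
have {}wE x : u 0 x * (s x)%:C = (\sum_y w 0 y) * (pi 0 x)%:C.
  by rewrite -wE ?d1 ?scale1r // mxE.
rewrite (eq_bigr (fun x => (\sum_y w 0 y) * (pi 0 x * h x)%:C)).
  by rewrite -mulr_sumr -rmorph_sum h0 rmorph0 mulr0.
by move=> x _; rewrite mxE !rmorphM mulrA wE mulrA.
Qed.

Lemma chain_reversible_bd : reversible_bd P pi (trel P).
Proof.
have [[pi0 pi1] _] := pi_stat.
split => //.
- by case: P_bd.
- exact: stat_gt0.
- exact: detailed_balance.
- exact: up_edge_gt0.
- exact: trel_ge1.
- by move=> h h0; rewrite /trel invrK /gap opprB addrCA subrr addr0 lambda_contraction.
Qed.

End Chain.

(** * Mixing times *)

(** With [y = 2 / T <= 1/2] one has [exp (- 2 y) <= 1 - y], and [2 y t <= 8 K]. *)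
Lemma expR_le_expn (R : realType) (r T K : R) t : 4 <= T ->
  1 - T^-1 - T^-1 < r -> t%:R <= 2 * K * T -> expR (- (8 * K)) <= r ^+ t.
Proof.
move=> T4 r_gt tK; have T0 : 0 < T by exact: lt_le_trans T4.
have Ti : T^-1 <= 4^-1 by rewrite lef_pV2 ?posrE.
have Ti0 : 0 < T^-1 by rewrite invr_gt0.
set y := 2 / T; have y2 : y <= 2^-1 by rewrite /y; lra.
have y0 : 0 < y by rewrite mulr_gt0.
have exp_le : expR (- (2 * y)) <= r.
  apply: (@le_trans _ _ (1 - y)); last by rewrite /y; lra.
  rewrite expRN -[leLHS]mul1r ler_pdivrMr ?expR_gt0 //.
  apply: (@le_trans _ _ ((1 - y) * (1 + 2 * y))); last first.
    by rewrite ler_wpM2l ?expR_ge1Dx //; lra.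
  have : 0 <= y * (1 - 2 * y) by rewrite mulr_ge0 ?(ltW y0) //; lra.
  by lra.
apply: (@le_trans _ _ (expR (- (2 * y)) ^+ t)); last first.
  by apply: lerXn2r; rewrite ?nnegrE ?expR_ge0 // (le_trans (expR_ge0 _) exp_le).
rewrite -expRM_natl ler_expR mulrN lerN2 /y.
have -> : t%:R * (2 * (2 / T)) = 4 * (t%:R / T) by ring.
have : t%:R / T <= 2 * K by rewrite ler_pdivrMr.
by lra.
Qed.

Section MixingTime.
Variables (R : realType) (N : nat) (P : 'M[R]_N.+1) (pi : 'rV[R]_N.+1) (delta : R).
Hypotheses (delta_gt0 : 0 < delta) (P_bd : birth_death P) (P_lazy : lazy delta P)
  (P_irr : irreducible P) (pi_stat : stationary P pi).
Local Notation d := (dist_stat P pi).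
Local Notation tm := (tmix P pi).
Local Notation T := (trel P).

Let d_cvg0 := dist_stat_cvg0 delta_gt0 P_bd P_lazy P_irr pi_stat.
Let chain_bd := chain_reversible_bd delta_gt0 P_bd P_lazy P_irr pi_stat.
Let pi_dist : distribution_on pi. Proof. by case: pi_stat. Qed.

Lemma dist_tmix (eps : R) : 0 < eps -> d (tm eps) <= eps.
Proof.
move=> /d_cvg0 ex_t; rewrite /tmix; case: pselect => // ex_t'.
by case: ex_minnP.
Qed.

Lemma tmix_le (eps : R) t : d t <= eps -> (tm eps <= t)%N.
Proof.
by rewrite /tmix; case: pselect => // ex_t dt; case: ex_minnP => m _; apply.
Qed.

Lemma tmix_anti (eps eps' : R) : 0 < eps -> eps <= eps' -> (tm eps' <= tm eps)%N.
Proof. by move=> eps0 le_eps; apply/tmix_le/(le_trans (dist_tmix eps0)). Qed.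

Lemma tmix_quarter_gt0 : (1 <= N)%N -> (0 < tm 4^-1)%N.
Proof.
move=> N1; rewrite lt0n; apply/eqP => tm0.
have := dist_tmix (eps := 4^-1); rewrite tm0 invr_gt0 => /(_ (ltr0n R 4)).
apply/negP; rewrite -ltNge.
have [x pix] : exists x, pi 0 x <= 2^-1.
  pose y : 'I_N.+1 := inord 1; have y0 : y != ord0 by rewrite -val_eqE /= inordK.
  have [?|lt0] := leP (pi 0 ord0) 2^-1; first by exists ord0.
  exists y; have := rbd_sum chain_bd; rewrite (bigD1 ord0) //= (bigD1 y) //=.
  have : 0 <= \sum_(i < N.+1 | (i != ord0) && (i != y)) pi 0 i.
    by apply: sumr_ge0 => i _; case: pi_dist.
  by move: lt0; lra.
apply: lt_le_trans (le_dist_stat P pi 0 x).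
pose f (y : 'I_N.+1) : R := (y == x)%:R.
have f01 y : 0 <= f y <= 1 by rewrite /f ler0n lern1 leq_b1.
have row_dist := stochasticX (rbd_stoch chain_bd) 0 x.
apply: lt_le_trans (tv_ge_test row_dist pi_dist f01).
rewrite (bigD1 x) //= big1 => [|y yx]; last by rewrite /f (negbTE yx) mulr0.
by rewrite /f eqxx expr0 !mxE eqxx mulr1n mulr1 addr0; move: pix; lra.
Qed.

(** The first summand bounds the two [sqrt(T M)] terms of [mixing_window]; the others collect the
    multiples of [T] and the rounding of times to integers. *)
Definition window_cst (eps : R) : R :=
  8 / eps * (1 + 2 / eps + 2 / eps ^+ 2) + (25 / eps ^+ 2) ^+ 2 + 2 + 2 / eps.

Lemma window_cst_gt0 (eps : R) : 0 < eps -> 0 < window_cst eps.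
Proof.
move=> eps0; have i0 : 0 < eps^-1 by rewrite invr_gt0.
have i20 : 0 < (eps ^+ 2)^-1 by rewrite invr_gt0 exprn_gt0.
by rewrite /window_cst !addr_gt0 ?mulr_gt0 ?addr_gt0 ?exprn_gt0 ?mulr_gt0.
Qed.

(** [M] is traded for [tau]: the lower bound at level [1 - 2 eps >= 1/4] gives
    [M - O(T) - O(sqrt(T M)) <= tau], AM-GM absorbs the root into [M / 2], and [T <= tau] does the
    rest. *)
Lemma tmix_window (eps : R) : 0 < eps <= 4^-1 -> T <= (tm 4^-1)%:R ->
  (tm eps)%:R - (tm (1 - 2 * eps))%:R <=
  window_cst eps * Num.sqrt ((tm 4^-1)%:R * T).
Proof.
move=> eps04 Ttau; case/andP: (eps04) => eps0 eps4.
have [M M0 [upper lower]] := mixing_window chain_bd eps04.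
set tau : R := (tm 4^-1)%:R in Ttau *.
set s := Num.sqrt (T * M) in upper lower.
have T1 : 1 <= T := rbd_T chain_bd; have T0 : 0 < T by exact: lt_le_trans T1.
have i0 : 0 < eps^-1 by rewrite invr_gt0.
have s0 : 0 <= s by exact: sqrtr_ge0.
set c := (25 / eps ^+ 2) ^+ 2 + 1 in upper.
have c0 : 0 <= c by rewrite addr_ge0 ?sqr_ge0.
have le_eps : (tm eps)%:R <= M + 2 / eps * s + c * T + 1.
  set B := M + 2 / eps * s + c * T.
  have B0 : 0 <= B by rewrite !addr_ge0 ?mulr_ge0 ?(ltW i0) ?(ltW T0).
  have /andP[lo hi] := truncn_itv B0.
  apply: (@le_trans _ _ (Num.truncn B).+1%:R).
    by rewrite ler_nat; apply/tmix_le/upper/ltW.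
  by rewrite -natr1 lerD2r.
have ge_1eps : M - 2 * T / eps - 2 / eps * s <= (tm (1 - 2 * eps))%:R.
  rewrite leNgt; apply/negP => /ltW /lower.
  by rewrite ltNge dist_tmix //; lra.
have tau_ge : (tm (1 - 2 * eps))%:R <= tau.
  by rewrite ler_nat; apply: tmix_anti; rewrite ?invr_gt0 //; lra.
have s2 : s ^+ 2 = T * M by rewrite sqr_sqrtr // mulr_ge0 // ltW.
have amgm : 2 / eps * s <= M / 2 + 2 / eps ^+ 2 * T.
  have sE : s = Num.sqrt T * Num.sqrt M by rewrite -sqrtrM // ltW.
  have := sqr_ge0 (Num.sqrt M - 2 / eps * Num.sqrt T).
  rewrite sqrrB exprMn !sqr_sqrtr ?(ltW T0) // exprMn exprVn sE; lra.
set k := 1 + 2 / eps + 2 / eps ^+ 2.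
have k1 : 1 <= 2 * k.
  have : 0 <= 2 / eps by rewrite mulr_ge0 ?ltW.
  have : 0 <= 2 / eps ^+ 2 by rewrite divr_ge0 ?sqr_ge0.
  by rewrite /k; lra.
have tau0 : 0 < tau by exact: lt_le_trans Ttau.
have M_le : M <= 2 * k * tau.
  have : (2 / eps + 2 / eps ^+ 2) * T <= (2 / eps + 2 / eps ^+ 2) * tau.
    by rewrite ler_wpM2l // addr_ge0 ?divr_ge0 ?sqr_ge0 ?ltW.
  by rewrite /k; move: ge_1eps tau_ge amgm; lra.
set w := Num.sqrt (tau * T).
have w0 : 0 <= w by exact: sqrtr_ge0.
have w2 : w ^+ 2 = tau * T by rewrite sqr_sqrtr // mulr_ge0 // ltW.
have T_le : T <= w.
  rewrite -ler_sqr ?nnegrE ?(ltW T0) // w2 expr2 ler_pM2r //.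
have s_le : s <= 2 * k * w.
  rewrite -ler_sqr ?nnegrE ?mulr_ge0 //; last by lra.
  rewrite s2 exprMn w2; apply: (@le_trans _ _ (T * (2 * k * tau))).
    by rewrite ler_pM2l.
  rewrite mulrCA [tau * T]mulrC; apply: ler_wpM2r; first by rewrite mulr_ge0 ?ltW.
  by rewrite expr2 ler_peMl //; lra.
have s_le' : 4 / eps * s <= 4 / eps * (2 * k * w).
  by rewrite ler_wpM2l // mulr_ge0 ?ltW.
have T_le' : (c + 1 + 2 / eps) * T <= (c + 1 + 2 / eps) * w.
  by rewrite ler_wpM2l //; have := mulr_gt0 (ltr0n R 2) i0; move: c0; lra.
have -> : window_cst eps * w = 4 / eps * (2 * k * w) + (c + 1 + 2 / eps) * w.
  by rewrite /window_cst /k /c; ring.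
move: le_eps ge_1eps T_le' s_le' T1; lra.
Qed.

Lemma delta_le1 : delta <= 1.
Proof.
apply: le_trans (P_lazy ord0) _; rewrite -(stoch_sum1 (rbd_stoch chain_bd) ord0).
rewrite (bigD1 ord0) //= lerDl sumr_ge0 // => y _.
exact: stoch_ge0 (rbd_stoch chain_bd) _ _.
Qed.

(* An eigenvalue of modulus close to [1 - 1 / T] keeps [d] bounded below for
   times of order [T]. *)
Lemma tmix_spectral_lower_bound (eps K : R) : 0 < eps -> 4 <= T ->
  (tm eps)%:R <= 2 * K * T -> expR (- (8 * K)) <= 2 * eps.
Proof.
move=> eps0 T4 tK; set t := tm eps in tK *.
have T0 : 0 < T by exact: lt_le_trans T4.
have Ti : T^-1 <= 4^-1 by rewrite lef_pV2 ?posrE.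
have Ti0 : 0 < T^-1 by rewrite invr_gt0.
have lamE : lambda P = 1 - T^-1 by rewrite /trel invrK /gap opprB addrCA subrr addr0.
have ne : nontrivial_moduli P !=set0.
  apply/set0P/eqP => E; have : lambda P = 0 by rewrite /lambda -/(nontrivial_moduli P) E sup0.
  by rewrite lamE; lra.
have hs : has_sup (nontrivial_moduli P).
  split=> //; exists (lambda P) => r; exact: lambda_ub delta_gt0 P_bd P_lazy P_irr pi_stat r.
(* A modulus within [1 / T] of the supremum is enough; this is the second [T^-1] in
   [expR_le_expn]. *)
have [r rM] := sup_adherent Ti0 hs; rewrite -/(lambda P) lamE => r_gt.
have [r0 rt] := moduli_le_dist pi P_bd t rM.
apply: le_trans (expR_le_expn T4 r_gt tK) (le_trans rt _).
by rewrite ler_pM2l // dist_tmix.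
Qed.

(* Laziness keeps a proportion [delta] of the mass in place at each step, so
   [d] cannot drop from [1 - eps] to [eps] in a single bounded step. *)
Lemma tmix_jump_lower_bound (eps : R) L : 0 < eps -> (0 < tm eps <= L)%N ->
  tm (1 - eps) = tm eps -> delta ^+ L <= 2 * eps.
Proof.
move=> eps0 /andP[t0 tL] tmE; set t := tm eps in t0 tL tmE.
have dL k : (k <= L)%N -> delta ^+ L <= delta ^+ k.
  by apply: ler_wiXn2l; [exact: ltW | exact: delta_le1].
rewrite leNgt; apply/negP => eps_lt.
have dpred : 1 - eps < d t.-1.
  rewrite ltNge; apply/negP => /tmix_le; rewrite tmE.
  by case: (t) t0 => // n _; rewrite /= ltnn.
have [x xtv] : exists x, 1 - eps < tv (row x (P ^+ t.-1)) pi.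
  apply: contrapT => /forallNP noneP; move: dpred; apply/negP; rewrite -leNgt.
  apply: dist_stat_le => [|x]; last by rewrite leNgt; apply/negP/noneP.
  have : delta ^+ L <= 1 by apply: exprn_ile1; [exact: ltW|exact: delta_le1].
  by move: eps_lt; lra.
have st := rbd_stoch chain_bd.
have pix : pi 0 x < eps.
  have := lt_le_trans xtv (tv_le_overlap x (stochasticX st _ x) pi_dist).
  rewrite ltrD2l ltrN2 gt_min mxE => /orP[|//] Px.
  have := le_lt_trans (lazy_diag delta_gt0 P_bd P_lazy t.-1 x) Px.
  move=> /(le_lt_trans (dL t.-1 (leq_trans (leq_pred _) tL))).
  by move: (delta ^+ L) eps_lt eps0 => D; lra.
pose f (y : 'I_N.+1) : R := (y == x)%:R.
have f01 y : 0 <= f y <= 1 by rewrite /f ler0n lern1 leq_b1.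
have := tv_ge_test (stochasticX st t x) pi_dist f01.
rewrite (bigD1 x) //= big1 => [|y yx]; last by rewrite /f (negbTE yx) mulr0.
rewrite /f eqxx mulr1 addr0 mxE => low.
have le_eps := le_trans low (le_trans (le_dist_stat P pi t x) (dist_tmix eps0)).
have := le_trans (dL t tL) (lazy_diag delta_gt0 P_bd P_lazy t x).
move: ((P ^+ t) x x) (delta ^+ L) le_eps pix eps_lt => p D; lra.
Qed.

End MixingTime.

(** [eps] and [eta] depend on [delta] and [K] only, so one level refutes cutoff along any
    subsequence with [tau <= K T]. The cases are [T >= 4], where eigenvalues decide, and [T < 4],
    where [tau < L]. *)
Lemma no_cutoff_profile (R : realType) (delta K : R) : 0 < delta -> 0 < K ->
  exists2 eps : R, 0 < eps <= 4^-1 & exists2 eta : R, 0 < eta &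
  forall (N : nat) (P : 'M[R]_N.+1) (pi : 'rV[R]_N.+1),
    birth_death P -> lazy delta P -> irreducible P -> stationary P pi ->
    (tmix P pi 4^-1)%:R <= K * trel P ->
    eta < `|(tmix P pi eps)%:R / (tmix P pi (1 - eps))%:R - 1|.
Proof.
move=> delta0 K0.
pose L := (Num.truncn (4 * K)).+1.
(* The divisions by 4 make [2 * eps] smaller than the lower bounds met in the two cases. *)
pose eps := Num.min 4^-1 (Num.min (expR (- (8 * K)) / 4) (delta ^+ L / 4)).
have eps0 : 0 < eps by rewrite !lt_min invr_gt0 !divr_gt0 ?expR_gt0 ?exprn_gt0 ?ltr0n.
have eps4 : eps <= 4^-1 by rewrite ge_min lexx.
have eps_exp : eps <= expR (- (8 * K)) / 4 by rewrite !ge_min lexx orbT.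
have eps_L : eps <= delta ^+ L / 4 by rewrite !ge_min lexx !orbT.
clearbody eps; exists eps; first by rewrite eps0.
have LK : 4 * K < L%:R by have /andP[] := truncn_itv (mulr_ge0 (ler0n R 4) (ltW K0)).
have L1 : (1 : R) <= L%:R by rewrite ler1n.
exists (2 * L%:R)^-1; first by rewrite invr_gt0 mulr_gt0 // (lt_le_trans ltr01).
move=> N P pi P_bd P_lazy P_irr pi_stat tauK.
rewrite ltNge; apply/negP.
set t1 := tmix P pi eps; set t2 := tmix P pi (1 - eps) => ratio.
have L0 : (0 : R) < L%:R by exact: lt_le_trans L1.
have iL : (2 * L%:R)^-1 < (1 : R) by rewrite invf_lt1 ?mulr_gt0 //; lra.
have t2_gt0 : (0 : R) < t2%:R.
  rewrite lt_def ler0n andbT; apply/eqP => t20; move: ratio.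
  by rewrite t20 invr0 mulr0 sub0r normrN normr1; move: iL; lra.
have diff : `|t1%:R - t2%:R| <= (2 * L%:R)^-1 * t2%:R :> R.
  have -> : t1%:R - t2%:R = (t1%:R / t2%:R - 1) * t2%:R :> R.
    by rewrite mulrBl mul1r divfK // gt_eqF.
  by rewrite normrM [`|t2%:R|]ger0_norm // ler_wpM2r.
have t2K : t2%:R <= K * trel P.
  apply: le_trans tauK; rewrite ler_nat.
  by apply: (tmix_anti delta0 P_bd P_lazy P_irr pi_stat); rewrite ?invr_gt0 //; lra.
have T1 := trel_ge1 delta0 P_bd P_lazy P_irr pi_stat.
have [T4|T4] := leP 4 (trel P).
  suff : expR (- (8 * K)) <= 2 * eps.
    by have := expR_gt0 (- (8 * K)); move: eps_exp; lra.
  apply: (tmix_spectral_lower_bound delta0 P_bd P_lazy P_irr pi_stat eps0 T4).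
  have : (2 * L%:R)^-1 * t2%:R <= 1 * t2%:R :> R by rewrite ler_wpM2r // ltW.
  by move: diff; rewrite ler_norml => /andP[_]; rewrite -/t1; lra.
have t2L : t2%:R < L%:R :> R.
  have : K * trel P <= K * 4 by rewrite ler_pM2l // ltW.
  by move: t2K LK; lra.
(* The choice of [eta] makes two integers differ by less than 1. *)
have t12 : t1 = t2.
  have lt1 : `|t1%:R - t2%:R| < 1 :> R.
    apply: le_lt_trans diff _; rewrite mulrC ltr_pdivrMr ?mulr_gt0 //; lra.
  move: lt1; rewrite ltr_norml => /andP[]; rewrite ltrBrDl ltrBlDl => lo hi.
  have lo' : (t2 < t1.+1)%N by rewrite -(ltr_nat R) -natr1; lra.
  have hi' : (t1 < t2.+1)%N by rewrite -(ltr_nat R) -natr1; lra.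
  by apply: anti_leq; rewrite -ltnS hi' -ltnS lo'.
suff : delta ^+ L <= 2 * eps by have := exprn_gt0 L delta0; move: eps_L; lra.
apply: (tmix_jump_lower_bound delta0 P_bd P_lazy P_irr pi_stat eps0).
  by rewrite -/t1 t12 -(ltr_nat R) t2_gt0 -(ler_nat R) ltW.
by rewrite -/t1 -/t2 t12.
Qed.

Theorem theorem3p1 (R : realType) (delta : R) (delta_gt0 : 0 < delta)
  (N : nat -> nat) (N_ge1 : forall n, (1 <= N n)%N)
  (P : forall n, 'M[R]_((N n).+1)) (pi : forall n, 'rV[R]_((N n).+1))
  (P_bd : forall n, birth_death (P n))
  (P_lazy : forall n, lazy delta (P n))
  (P_irr : forall n, irreducible (P n))
  (pi_stat : forall n, stationary (P n) (pi n)) :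
  let tm : nat -> R -> nat := fun n eps => tmix (P n) (pi n) eps in
  let tr : nat -> R := fun n => trel (P n) in
  (cutoff tm <-> tr =o_\oo (fun n => (tm n 4^-1)%:R : R)) /\
  (cutoff tm ->
   cutoff_window tm (fun n => Num.sqrt ((tm n 4^-1)%:R * tr n))).
Proof.
move=> tm tr; set tau := fun n => (tm n 4^-1)%:R : R.
pose w n := Num.sqrt (tau n * tr n).
have tau1 n : 1 <= tau n.
  by rewrite ler1n (tmix_quarter_gt0 delta_gt0 (P_bd n) (P_lazy n) (P_irr n)).
have tr1 n : 1 <= tr n.
  exact: (trel_ge1 delta_gt0 (P_bd n) (P_lazy n) (P_irr n) (pi_stat n)).
have tau0 n : 0 < tau n by exact: lt_le_trans (tau1 n).
have tr0 n : 0 < tr n by exact: lt_le_trans (tr1 n).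
have anti n (e e' : R) : 0 < e -> e <= e' -> ((tm n e')%:R : R) <= (tm n e)%:R.
  move=> e0 le_e; rewrite ler_nat.
  exact: (tmix_anti delta_gt0 (P_bd n) (P_lazy n) (P_irr n) (pi_stat n)).
have tr_oP : tr =o_\oo tau <->
    forall c : R, 0 < c -> \forall n \near \oo, tr n <= c * tau n.
  rewrite eqoP; split=> tr_o c c0; have := tr_o c c0; apply: filterS => n;
    by rewrite !ger0_norm // ltW.
have cutoff_o : cutoff tm -> tr =o_\oo tau.
  move=> co; apply/tr_oP => c c0.
  have ci0 : 0 < c^-1 by rewrite invr_gt0.
  have [e /andP[e0 e4] [eta eta0 noco]] := no_cutoff_profile delta_gt0 ci0.
  have e01 : 0 < e < 1 by rewrite e0; lra.
  have /cvgrPdist_le/(_ _ eta0) := co e e01; apply: filterS => n ratio.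
  rewrite leNgt; apply/negP => tr_gt.
  have := noco _ _ _ (P_bd n) (P_lazy n) (P_irr n) (pi_stat n).
  rewrite -/(tm n _) -/(tau n) ler_pdivlMl // => /(_ (ltW tr_gt)).
  by rewrite ltNge distrC ratio.
have window_ev : tr =o_\oo tau -> forall e : R, 0 < e < 1 ->
    exists2 c : R, 0 < c &
      \forall n \near \oo, (tm n e)%:R - (tm n (1 - e))%:R <= c * w n.
  move=> /tr_oP tr_o e /andP[e0 e1].
  have [e2|e2] := leP 2^-1 e.
    exists 1 => //; near=> n; rewrite mul1r.
    apply: le_trans (sqrtr_ge0 _); rewrite subr_le0; apply: anti; lra.
  (* [tmix_window] compares [eps] with [1 - 2 eps]; at [eps = e / 2] its upper level is [1 - e]. *)
  have e40 : 0 < e / 2 <= 4^-1 by apply/andP; split; lra.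
  exists (window_cst (e / 2)); first by apply: window_cst_gt0; case/andP: e40.
  apply: filterS (tr_o 1 ltr01) => n; rewrite mul1r => tr_le.
  have := tmix_window delta_gt0 (P_bd n) (P_lazy n) (P_irr n) (pi_stat n) e40 tr_le.
  apply: le_trans; rewrite -!/(tm n _) (_ : 2 * (e / 2) = e); last by field.
  by rewrite lerD2r; apply: anti; lra.
have w_o : tr =o_\oo tau -> forall c : R, 0 < c ->
    \forall n \near \oo, w n <= c * tau n.
  move=> /tr_oP tr_o c c0.
  apply: filterS (tr_o (c ^+ 2) (exprn_gt0 2 c0)) => n tr_le.
  have ct : 0 <= c * tau n by rewrite mulr_ge0 ?ltW.
  rewrite -ler_sqr ?nnegrE ?sqrtr_ge0 // sqr_sqrtr; last by rewrite mulr_ge0 ?ltW.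
  by rewrite exprMn expr2 mulrCA ler_pM2l // mulrA -expr2.
have window : tr =o_\oo tau -> cutoff_window tm w.
  move=> tr_o; split.
    apply/eqoP => c c0; apply: filterS (w_o tr_o c c0) => n.
    by rewrite !ger0_norm ?sqrtr_ge0 // ltW.
  move=> e e01; have [c c0 [n0 _ cP]] := window_ev tr_o e e01.
  (* The window must hold for every [n]: as [w n >= 1], the finitely many early terms are absorbed
     by adding [S] to the constant. *)
  pose S : R := \sum_(n < n0) (tm n e)%:R.
  have S0 : 0 <= S by exact: sumr_ge0.
  exists (c + S) => [|n]; first by rewrite ltr_wpDr.
  have w1 : 1 <= w n by rewrite -[leLHS]sqrtr1 ler_wsqrtr // mulr_ege1.
  have w0 : 0 <= w n by exact: le_trans w1.
  have [n0n|nn0] := leqP n0 n.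
    apply: le_trans (cP n n0n) _; rewrite ler_wpM2r // lerDl.
    exact: S0.
  apply: (@le_trans _ _ S).
    rewrite lerBlDr ler_wpDr // /S (bigD1 (Ordinal nn0)) //= ler_wpDr //.
    exact: sumr_ge0.
  rewrite -[leLHS]mulr1; apply: ler_pM => //.
  by rewrite lerDr ltW.
split; last by move=> /cutoff_o/window.
split=> // tr_o e /andP[e0 e1].
(* All levels are comparable with [tau]: [tau] is at most the time at [e''], which exceeds that at
   [1 - e''] by at most [tau / 2] eventually, and [1 - e'' >= e']. *)
have tm_ge (e' : R) : 0 < e' < 1 -> \forall n \near \oo, tau n <= 2 * (tm n e')%:R.
  move=> /andP[e'0 e'1]; pose e'' := Num.min (1 - e') 4^-1.
  have e''0 : 0 < e'' by rewrite lt_min invr_gt0 ltr0n subr_gt0 e'1.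
  have e''4 : e'' <= 4^-1 by rewrite ge_min lexx orbT.
  have e''e : e'' <= 1 - e' by rewrite ge_min lexx.
  clearbody e''.
  have e''01 : 0 < e'' < 1 by rewrite e''0; lra.
  have [c c0 cP] := window_ev tr_o e'' e''01.
  have c20 : 0 < (2 * c)^-1 by rewrite invr_gt0 mulr_gt0.
  near=> n.
  have h1 : (tm n e'')%:R - (tm n (1 - e''))%:R <= c * w n by near: n.
  have h2 : w n <= (2 * c)^-1 * tau n by near: n; exact: w_o.
  have h3 : tau n <= (tm n e'')%:R by exact: anti.
  have h4 : (tm n (1 - e''))%:R <= (tm n e')%:R :> R by apply: anti; lra.
  have h5 : c * w n <= 2^-1 * tau n.
    apply: le_trans (ler_wpM2l (ltW c0) h2) _.
    by rewrite mulrA invfM mulrCA divff ?mulr1 // gt_eqF.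
  by move: h1 h3 h4 h5; lra.
have e'01 : 0 < 1 - e < 1 by apply/andP; split; lra.
have e01 : 0 < e < 1 by rewrite e0.
have [c c0 cP] := window_ev tr_o e e01.
(* Using the window at both [e] and [1 - e] bounds the difference with either sign. *)
have [c' c'0 c'P] := window_ev tr_o _ e'01.
apply/cvgrPdist_le => eta eta0.
pose k := eta / (2 * (c + c')).
have k0 : 0 < k by rewrite divr_gt0 // mulr_gt0 // addr_gt0.
near=> n.
have h1 : (tm n e)%:R - (tm n (1 - e))%:R <= c * w n by near: n.
have h2 : (tm n (1 - e))%:R - (tm n (1 - (1 - e)))%:R <= c' * w n by near: n.
have h3 : tau n <= 2 * (tm n (1 - e))%:R by near: n; exact: tm_ge.
have h4 : w n <= k * tau n by near: n; exact: w_o.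
have w0 : 0 <= w n by exact: sqrtr_ge0.
move: h2; rewrite subKr => h2.
move: h1 h2 h3; set a := (tm n e)%:R; set b := (tm n (1 - e))%:R => h1 h2 h3.
have b0 : 0 < b by rewrite -(pmulr_rgt0 _ (ltr0n R 2)); exact: lt_le_trans h3.
have -> : 1 - a / b = (b - a) / b by rewrite mulrBl divff // gt_eqF.
rewrite normrM (ger0_norm (_ : 0 <= b^-1)) ?invr_ge0 ?(ltW b0) // ler_pdivrMr //.
have ab : `|b - a| <= (c + c') * w n.
  have := mulr_ge0 (ltW c0) w0; have := mulr_ge0 (ltW c'0) w0.
  by rewrite ler_norml mulrDl => ? ?; apply/andP; split; lra.
apply: le_trans ab _.
apply: (@le_trans _ _ ((c + c') * (k * (2 * b)))).
  apply: ler_wpM2l; first by rewrite addr_ge0 // ltW.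
  by apply: le_trans h4 _; rewrite ler_pM2l.
rewrite le_eqVlt; apply/orP; left; apply/eqP; rewrite /k; field.
by rewrite gt_eqF // addr_gt0.
Unshelve. all: by end_near.
Qed.
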